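(* There is an absolute constant $c>0$ such that the following holds. Let $\varepsilon\in(0,1)$ and let $G$ be an $n$-vertex graph which is $\varepsilon$-far from being induced $C_4$-free. Then $G$ contains at least $n^4/2^{(1/\varepsilon)^c}$ induced copies of $C_4$.
   Context: An $n$-vertex graph $G$ is $\varepsilon$-far from satisfying a property $\mathcal P$ if one must add and/or delete at least $\varepsilon n^2$ edges of $G$ in order to obtain a graph satisfying $\mathcal P$. A graph is induced $H$-free if it contains no induced subgraph isomorphic to $H$. An induced copy of $C_4$ in $G$ is a set of $4$ vertices of $G$ whose induced subgraph is a $4$-cycle. *)

(* Defs.v *)
From mathcomp Require Import all_boot.
From Stdlib Require Import Reals.

Set Implicit Arguments.
Unset Strict Implicit.
Unset Printing Implicit Defensive.

Definition simple_graph (n : nat) (e : rel 'I_n) : Prop :=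
  (forall u v, e u v = e v u) /\ (forall u, e u u = false).

Definition induces_C4 (n : nat) (e : rel 'I_n) (S : {set 'I_n}) : bool :=
  [exists a : 'I_n, exists b : 'I_n, exists c : 'I_n, exists d : 'I_n,
     [&& S == [set a; b; c; d], #|S| == 4,
         e a b, e b c, e c d, e d a, ~~ e a c & ~~ e b d]].

Definition induced_C4_free (n : nat) (e : rel 'I_n) : Prop :=
  forall S : {set 'I_n}, ~~ induces_C4 e S.

Definition num_induced_C4 (n : nat) (e : rel 'I_n) : nat :=
  #|[set S : {set 'I_n} | induces_C4 e S]|.

Definition edit_dist (n : nat) (e e' : rel 'I_n) : nat :=
  #|[set p : 'I_n * 'I_n | (p.1 < p.2)%N && (e p.1 p.2 != e' p.1 p.2)]|.

Definition eps_far_C4free (n : nat) (e : rel 'I_n) (eps : R) : Prop :=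
  forall e' : rel 'I_n, simple_graph e' -> induced_C4_free e' ->
    (eps * INR n ^ 2 <= INR (edit_dist e e'))%R.

(* Main.v *)
(* A graph with few induced 4-cycles is made induced-C4-free by few edits, as
   follows.  A dense induced-C4-poor graph contains a large near-clique
   (a common neighbourhood of a non-adjacent pair, or a neighbourhood), so the
   vertices split into polynomially many near-cliques and a sparse set [Y].  The
   graph between two near-cliques is nearly a chain graph, since an induced
   matching of size 2 closes up to a C4; hence it is governed by degrees.  Refining
   every near-clique by its degrees to all the others gives exponentially many
   classes, and this is where the exponential bound comes from.  One random
   representative per class spans an induced-C4-free graph, whose blow-up [e1] is
   close to [e] outside [Y].  Finally, few non-adjacent pairs lie in the
   neighbourhood of a typical [y] in [Y], for otherwise many such pairs would have
   two common, typically non-adjacent, neighbours in [Y].  As [e1] is induced-C4-free,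
   the non-edges inside such a neighbourhood have a small vertex cover; deleting the
   edges from [y] to the cover and the edges inside [Y] removes all induced C4s. *)
Require Import Defs.
From mathcomp Require Import all_boot.
From mathcomp Require all_order all_algebra ring lra zify.
From Stdlib Require Import Reals.
From Stdlib Require Lra.

Set Implicit Arguments.
Unset Strict Implicit.
Unset Printing Implicit Defensive.

(* The module confines the rebinding of [%R] to MathComp rings. *)
Module InducedC4.
Import all_boot all_order all_algebra ring lra zify.
Import Order.TTheory GRing.Theory Num.Theory.
Local Open Scope ring_scope.

(** * Sums over finite types and Cauchy-Schwarz *)

Lemma sum_in_indicator (I : finType) (P : pred I) (F : I -> rat) :
  \sum_(i | P i) F i = \sum_i (P i)%:R * F i.
Proof. by rewrite big_mkcond; apply: eq_bigr => i _; case: (P i); rewrite ?mul1r ?mul0r. Qed.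

Lemma sum_pair_indicator (I : finType) (P : rel I) (F : I -> I -> rat) :
  \sum_(p : I * I | P p.1 p.2) F p.1 p.2 = \sum_i \sum_j (P i j)%:R * F i j.
Proof. by rewrite sum_in_indicator pair_bigA. Qed.

Lemma sum_const (I : finType) (A : {pred I}) (c : rat) :
  \sum_(i in A) c = c * #|A|%:R.
Proof. by rewrite sumr_const mulr_natr. Qed.

Lemma card_indicator (I : finType) (A : {pred I}) :
  #|A|%:R = \sum_i (i \in A)%:R :> rat.
Proof. by rewrite -sum1_card natr_sum (sum_in_indicator (mem A)); apply: eq_bigr => i _; rewrite mulr1. Qed.

Lemma cauchy_schwarz_card (I : finType) (P : pred I) (f : I -> rat) :
  (\sum_(i | P i) f i) ^+ 2 <= #|P|%:R * \sum_(i | P i) f i ^+ 2.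
Proof.
set c := \sum_(i | P i) f i; set k : rat := #|P|%:R.
have [k0|k0] := eqVneq k 0.
  have P0 : P =i pred0 by apply/card0_eq/eqP; rewrite -(eqr_nat rat) -/k k0.
  by rewrite k0 mul0r /c big_pred0 ?expr0n // => i; apply: P0.
have kp : 0 < k by rewrite lt_neqAle eq_sym k0 ler0n.
have : 0 <= \sum_(i | P i) (k * f i - c) ^+ 2 by apply: sumr_ge0 => i _; rewrite sqr_ge0.
have -> : \sum_(i | P i) (k * f i - c) ^+ 2
   = k ^+ 2 * (\sum_(i | P i) f i ^+ 2) - 2 * k * c * c + k * c ^+ 2.
  have -> : k * c ^+ 2 = \sum_(i | P i) c ^+ 2 by rewrite sumr_const mulr_natl.
  have -> : 2 * k * c * c = \sum_(i | P i) (2 * k * c * f i) by rewrite -mulr_sumr.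
  rewrite mulr_sumr -sumrB -big_split /=.
  by apply: eq_bigr => i _; ring.
have -> : k ^+ 2 * (\sum_(i | P i) f i ^+ 2) - 2 * k * c * c + k * c ^+ 2
  = k * (k * (\sum_(i | P i) f i ^+ 2) - c ^+ 2) by ring.
by rewrite pmulr_rge0 // subr_ge0.
Qed.

Lemma ler_sum_subset (I : finType) (F : I -> rat) (A B : {set I}) :
  (forall i, 0 <= F i) -> A \subset B -> \sum_(i in A) F i <= \sum_(i in B) F i.
Proof.
move=> F0 AB; rewrite [leRHS](big_setID A) /= (setIidPr AB) lerDl.
exact: sumr_ge0.
Qed.

Lemma sum_const_pred (I : finType) (P : pred I) (c : rat) :
  \sum_(i | P i) c = c * #|P|%:R.
Proof. by rewrite -sum_const; apply: eq_bigl. Qed.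

(** * Labelled induced 4-cycles and non-edges *)

Definition na (T : finType) (e : rel T) : rel T := fun x y => (x != y) && ~~ e x y.

(** Quadruples are ordered, so one induced 4-cycle is counted several times. For irreflexive [e] the
    four vertices are automatically distinct. *)
Definition c4 (T : finType) (e : rel T) (a b c d : T) : bool :=
  [&& e a b, e b c, e c d, e d a, na e a c & na e b d].

Definition c4_count (T : finType) (e : rel T) : rat :=
  \sum_a \sum_b \sum_c \sum_d (c4 e a b c d)%:R.

Definition non_edges (T : finType) (e : rel T) (X : {set T}) : rat :=
  \sum_(x in X) \sum_(y in X) (na e x y)%:R.

Definition edge_count (T : finType) (e : rel T) (X : {set T}) : rat :=
  \sum_(x in X) \sum_(y in X) (e x y)%:R.

Lemma sum2_in_indicator (T : finType) (r : rel T) (X Y : {set T}) :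
  \sum_(x in X) \sum_(y in Y) (r x y)%:R =
  \sum_x \sum_y ([&& x \in X, y \in Y & r x y])%:R :> rat.
Proof.
rewrite sum_in_indicator; apply: eq_bigr => x _; rewrite sum_in_indicator mulr_sumr.
by apply: eq_bigr => y _; rewrite -!natrM !mulnb.
Qed.

Lemma non_edgesE (T : finType) (e : rel T) (X : {set T}) :
  non_edges e X = \sum_x \sum_y ([&& x \in X, y \in X & na e x y])%:R.
Proof. exact: sum2_in_indicator. Qed.

Lemma non_edges_ge0 (T : finType) (e : rel T) X : 0 <= non_edges e X.
Proof. by do 2!apply: sumr_ge0 => ? _; rewrite ler0n. Qed.

Lemma c4_count_ge0 (T : finType) (e : rel T) : 0 <= c4_count e.
Proof. by do 4!apply: sumr_ge0 => ? _; rewrite ler0n. Qed.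

(** * Near-cliques in dense graphs with few induced 4-cycles *)

Section NearClique.
Variables (T : finType) (e : rel T).
Hypothesis esym : symmetric e.
Local Notation n := (#|T|%:R : rat).

Let nbr (U : {set T}) w := [set x in U | e w x].
Let cn (U : {set T}) u v := [set x in U | e u x && e v x].

(** Double counting of the triples formed by a non-adjacent pair in [A] and a common neighbour of it
    in [B]. *)
Lemma cherries_non_edges (A B : {set T}) :
  \sum_(w in B) non_edges e (nbr A w) =
  \sum_(p : T * T | [&& p.1 \in A, p.2 \in A & na e p.1 p.2]) #|cn B p.1 p.2|%:R.
Proof.
transitivity (\sum_w \sum_u \sum_v ([&& w \in B, u \in A, v \in A, e w u, e w v & na e u v])%:R : rat).
  rewrite sum_in_indicator; apply: eq_bigr => w _; rewrite non_edgesE mulr_sumr.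
  apply: eq_bigr => u _; rewrite mulr_sumr; apply: eq_bigr => v _.
  rewrite !inE -natrM mulnb.
  by case: (w \in B); case: (u \in A); case: (v \in A); case: (e w u); case: (e w v).
transitivity (\sum_u \sum_v \sum_w ([&& w \in B, u \in A, v \in A, e w u, e w v & na e u v])%:R : rat).
  by rewrite exchange_big; apply: eq_bigr => u _; rewrite exchange_big.
rewrite (sum_pair_indicator (fun u v => [&& u \in A, v \in A & na e u v]) (fun u v => #|cn B u v|%:R)).
apply: eq_bigr => u _; apply: eq_bigr => v _.
rewrite card_indicator mulr_sumr; apply: eq_bigr => w _.
rewrite inE (esym u w) (esym v w) -natrM mulnb.
by case: (w \in B); case: (u \in A); case: (v \in A); case: (e w u); case: (e w v); case: (na e u v).
Qed.

(** Two non-adjacent common neighbours of a non-adjacent pair form an induced 4-cycle with it. *)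
Lemma non_edges_common_nbrs (A B : {set T}) :
  \sum_(p : T * T | [&& p.1 \in A, p.2 \in A & na e p.1 p.2]) non_edges e (cn B p.1 p.2)
  <= c4_count e.
Proof.
rewrite (sum_pair_indicator (fun u v => [&& u \in A, v \in A & na e u v]) (fun u v => non_edges e (cn B u v))).
rewrite /c4_count; apply: ler_sum => u _; rewrite [leRHS]exchange_big.
apply: ler_sum => v _; rewrite non_edgesE mulr_sumr.
apply: ler_sum => w _; rewrite mulr_sumr.
apply: ler_sum => x _; rewrite !inE -!natrM !mulnb ler_nat /c4 (esym w v) (esym x u).
by case: (w \in B); case: (u \in A); case: (v \in A); case: (e u w); case: (e v w); case: (na e u v);
 case: (x \in B); case: (e u x); case: (e v x); case: (na e w x).
Qed.

(* Vertices [w] of a sparse set [B] seldom see a non-adjacent pair in [A]: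
   otherwise some such pairs have many common neighbours in [B], nearly all
   pairs of which are non-adjacent. *)
Lemma sum_nbr_non_edges_le (A B : {set T}) :
  (\sum_(w in B) non_edges e (nbr A w)) ^+ 2 <=
  n ^+ 2 * (c4_count e + n ^+ 2 * (edge_count e B + n)).
Proof.
set Q := fun p : T * T => [&& p.1 \in A, p.2 \in A & na e p.1 p.2].
rewrite cherries_non_edges; apply: (le_trans (cauchy_schwarz_card Q _)).
have cQ : #|Q|%:R <= n ^+ 2 by rewrite -natrX ler_nat -mulnn -card_prod max_card.
apply: ler_pM; rewrite ?ler0n ?sumr_ge0 //; first by move=> *; rewrite sqr_ge0.
have e0 : 0 <= edge_count e B + n.
  by rewrite addr_ge0 ?ler0n // sumr_ge0 // => x _; rewrite sumr_ge0 // => y _; rewrite ler0n.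
apply: (@le_trans _ _ (\sum_(p | Q p) (non_edges e (cn B p.1 p.2) + (edge_count e B + n)))); last first.
  rewrite big_split; apply: lerD; first exact: non_edges_common_nbrs.
  by rewrite sum_const_pred mulrC ler_wpM2r.
apply: ler_sum => -[u v] _ /=; set C := cn B u v.
have CB : C \subset B by apply/subsetP => x; rewrite inE => /andP[].
(* Only the non-edges among the pairs in [C] yield 4-cycles; edges and the diagonal are paid for by
   [edge_count e B + n]. *)
have -> : #|C|%:R ^+ 2 = non_edges e C + (edge_count e C + \sum_(x in C) \sum_(y in C) (x == y)%:R * (~~ e x y)%:R) :> rat.
  rewrite (_ : #|C|%:R ^+ 2 = \sum_(x in C) \sum_(y in C) 1); last by rewrite !sum_const mul1r expr2.
  rewrite /non_edges /edge_count -!big_split; apply: eq_bigr => x _.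
  rewrite -!big_split; apply: eq_bigr => y _ /=.
  by rewrite /na; case: eqVneq => [->|_]; case: (e _ _).
rewrite lerD2l lerD //.
  rewrite /edge_count; apply: (@le_trans _ _ (\sum_(x in C) \sum_(y in B) (e x y)%:R)).
    by apply: ler_sum => x _; apply: ler_sum_subset.
  by apply: ler_sum_subset => // x; apply: sumr_ge0.
apply: (@le_trans _ _ (\sum_(x in C) 1)); last by rewrite sum_const mul1r ler_nat max_card.
apply: ler_sum => x xC; rewrite (bigD1 x) //= big1 ?addr0 => [|y /andP[_ yx]].
  by rewrite eqxx mul1r lern1 leq_b1.
by rewrite eq_sym (negPf yx) mul0r.
Qed.

(** Let [P] count the triples in [U] of a vertex and two non-adjacent neighbours of it. If [P] is
    small, neighbourhoods are near-cliques on average. If [P] is large, non-adjacent pairs have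
    large common neighbourhoods by Cauchy-Schwarz, and few 4-cycles leave few non-edges in them. *)
Lemma near_clique (U : {set T}) (alpha delta : rat) :
  (0 < #|T|)%N -> 0 < alpha <= 1 -> 0 < delta <= 1 ->
  alpha * n ^+ 2 <= edge_count e U ->
  c4_count e < delta * (delta * alpha ^+ 2 / 2) ^+ 2 / 2 * n ^+ 4 ->
  exists2 X : {set T}, X \subset U &
    delta * alpha ^+ 2 / 4 * n <= #|X|%:R /\ non_edges e X <= delta * #|X|%:R ^+ 2.
Proof.
move=> T0 /andP[a0 a1] /andP[d0 d1] hU hN.
set beta := delta * alpha ^+ 2 / 2.
have n0 : 0 < n by rewrite ltr0n.
have b0 : 0 < beta by rewrite /beta divr_gt0 ?mulr_gt0 ?exprn_gt0.
have a21 : alpha ^+ 2 <= 1 by apply: exprn_ile1 => //; exact: ltW.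
have bd : beta <= delta by rewrite /beta; nra.
have b1 : beta <= 1 by lra.
have [n0W b0W d0W a0W] : [/\ 0 <= n, 0 <= beta, 0 <= delta & 0 <= alpha] by split; exact: ltW.
(* One quantity, suited to averaging, controls both conclusions: its lower bound makes [X] large,
   its sign limits the non-edges. *)
have big (X : {set T}) : delta * beta ^+ 2 / 2 * n ^+ 2 <= delta * #|X|%:R ^+ 2 - non_edges e X ->
    delta * alpha ^+ 2 / 4 * n <= #|X|%:R /\ non_edges e X <= delta * #|X|%:R ^+ 2.
  move=> h; have := non_edges_ge0 e X => h0.
  have k0 : 0 <= #|X|%:R :> rat by rewrite ler0n.
  have bn0 : 0 <= beta ^+ 2 / 2 * n ^+ 2 by rewrite mulr_ge0 ?divr_ge0 ?sqr_ge0.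
  have dbn0 : delta * beta ^+ 2 / 2 * n ^+ 2 = delta * (beta ^+ 2 / 2 * n ^+ 2) by field.
  have dbn1 : 0 <= delta * (beta ^+ 2 / 2 * n ^+ 2) by rewrite mulr_ge0 //.
  split; last by lra.
  have -> : delta * alpha ^+ 2 / 4 = beta / 2 by rewrite /beta; field.
  rewrite -(@ler_pXn2r _ 2) ?nnegrE ?mulr_ge0 ?divr_ge0 //.
  have : beta ^+ 2 / 2 * n ^+ 2 <= #|X|%:R ^+ 2 by rewrite -(ler_pM2l d0); lra.
  have -> : (beta / 2 * n) ^+ 2 = beta ^+ 2 / 2 * n ^+ 2 / 2 by field.
  lra.
have sumN : \sum_(w in U) #|nbr U w|%:R = edge_count e U.
  apply: eq_bigr => w wU; rewrite card_indicator [RHS]sum_in_indicator.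
  by apply: eq_bigr => x _; rewrite -natrM mulnb !inE.
have sumN2 : alpha ^+ 2 * n ^+ 3 <= \sum_(w in U) #|nbr U w|%:R ^+ 2 :> rat.
  have := cauchy_schwarz_card (mem U) (fun w => #|nbr U w|%:R).
  rewrite sumN => cs.
  have s0 : 0 <= \sum_(w in U) #|nbr U w|%:R ^+ 2 :> rat by apply: sumr_ge0 => w _; rewrite sqr_ge0.
  have cU : #|U|%:R <= n by rewrite ler_nat max_card.
  have h1 : (alpha * n ^+ 2) ^+ 2 <= edge_count e U ^+ 2.
    by rewrite ler_pXn2r ?nnegrE // ?(le_trans _ hU) // mulr_ge0 ?sqr_ge0 //.
  have h2 : #|U|%:R * (\sum_(w in U) #|nbr U w|%:R ^+ 2) <= n * (\sum_(w in U) #|nbr U w|%:R ^+ 2).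
    exact: ler_wpM2r.
  have h3 := le_trans (le_trans h1 cs) h2.
  rewrite -(ler_pM2l n0); apply: le_trans h3.
  by rewrite le_eqVlt; apply/orP; left; apply/eqP; ring.
set P := \sum_(w in U) non_edges e (nbr U w).
have [hP|hP] := ltP P (beta * n ^+ 3).
  case: (boolP [exists w in U, delta * beta ^+ 2 / 2 * n ^+ 2 <= delta * #|nbr U w|%:R ^+ 2 - non_edges e (nbr U w)]).
    case/exists_inP => w wU /big h; exists (nbr U w) => //.
    by apply/subsetP => x; rewrite inE => /andP[].
  rewrite negb_exists_in => /forall_inP H; exfalso.
  have : \sum_(w in U) (delta * #|nbr U w|%:R ^+ 2 - non_edges e (nbr U w)) <= \sum_(w in U) (delta * beta ^+ 2 / 2 * n ^+ 2).
    by apply: ler_sum => w wU; rewrite ltW // ltNge H.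
  rewrite sumrB sum_const -mulr_sumr -/P => h.
  have cU : #|U|%:R <= n by rewrite ler_nat max_card.
  have h1 : delta * (alpha ^+ 2 * n ^+ 3) <= delta * (\sum_(w in U) #|nbr U w|%:R ^+ 2).
    by rewrite ler_pM2l.
  have h2 : delta * beta ^+ 2 / 2 * n ^+ 2 * #|U|%:R <= delta * beta ^+ 2 / 2 * n ^+ 2 * n.
    by apply: ler_wpM2l => //; rewrite !mulr_ge0 ?sqr_ge0 ?invr_ge0 //.
  have e1 : delta * (alpha ^+ 2 * n ^+ 3) = 2 * (beta * n ^+ 3) by rewrite /beta; field.
  have e2 : delta * beta ^+ 2 / 2 * n ^+ 2 * n = delta * beta / 2 * (beta * n ^+ 3) by field.
  have e3 : delta * beta / 2 * (beta * n ^+ 3) <= beta * n ^+ 3.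
    by rewrite ler_piMl ?mulr_ge0 ?exprn_ge0 //; nra.
  lra.
set Q := fun p : T * T => [&& p.1 \in U, p.2 \in U & na e p.1 p.2].
case: (boolP [exists p : T * T, Q p && (delta * beta ^+ 2 / 2 * n ^+ 2 <= delta * #|cn U p.1 p.2|%:R ^+ 2 - non_edges e (cn U p.1 p.2))]).
  case/existsP => -[u v] /andP[_ /big h]; exists (cn U u v) => //.
  by apply/subsetP => x; rewrite inE => /andP[].
rewrite negb_exists => /forallP H; exfalso.
have : \sum_(p | Q p) (delta * #|cn U p.1 p.2|%:R ^+ 2 - non_edges e (cn U p.1 p.2)) <= \sum_(p | Q p) (delta * beta ^+ 2 / 2 * n ^+ 2).
  by apply: ler_sum => p Qp; have := H p; rewrite Qp /= -ltNge => /ltW.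
rewrite sumrB sum_const -mulr_sumr => h.
have cQ : #|Q|%:R <= n ^+ 2 by rewrite -natrX ler_nat -mulnn -card_prod max_card.
have h1 := non_edges_common_nbrs U U; rewrite -/Q in h1.
have := cauchy_schwarz_card Q (fun p => #|cn U p.1 p.2|%:R).
rewrite -cherries_non_edges -/P => cs.
set S2 := \sum_(p | Q p) _ ^+ 2 in h cs.
have S20 : 0 <= S2 by apply: sumr_ge0 => p _; rewrite sqr_ge0.
have h2 : (beta * n ^+ 3) ^+ 2 <= P ^+ 2.
  have bn0 : 0 <= beta * n ^+ 3 by rewrite mulr_ge0 ?exprn_ge0.
  by rewrite ler_pXn2r ?nnegrE // (le_trans bn0).
have h3 : #|Q|%:R * S2 <= n ^+ 2 * S2 by apply: ler_wpM2r.
have h4 : beta ^+ 2 * n ^+ 4 <= S2.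
  rewrite -(@ler_pM2l _ (n ^+ 2)) ?exprn_gt0 //; apply: le_trans h3; apply: le_trans cs.
  by rewrite (le_trans _ h2) // le_eqVlt; apply/orP; left; apply/eqP; ring.
have h5 : delta * (beta ^+ 2 * n ^+ 4) <= delta * S2 by rewrite ler_pM2l.
have h6 : delta * beta ^+ 2 / 2 * n ^+ 2 * #|Q|%:R <= delta * beta ^+ 2 / 2 * n ^+ 2 * n ^+ 2.
  by apply: ler_wpM2l => //; rewrite !mulr_ge0 ?sqr_ge0 ?invr_ge0 //.
have e1 : delta * beta ^+ 2 / 2 * n ^+ 2 * n ^+ 2 = delta * (beta ^+ 2 * n ^+ 4) / 2 by field.
have e2 : delta * beta ^+ 2 / 2 * n ^+ 4 = delta * (beta ^+ 2 * n ^+ 4) / 2 by field.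
rewrite -/beta e2 in hN.
lra.
Qed.
End NearClique.

(** * Partition into near-cliques and a sparse remainder *)

Definition part (T : finType) (Y : {set T}) (I : eqType) (col : T -> I) (i : I) : {set T} :=
  [set x | (x \notin Y) && (col x == i)].

(** A colour may have no vertices, hence the alternative to the lower bound [b]. *)
Definition near_cliques (T : finType) (e : rel T) (b d : rat) (Y : {set T})
    (I : eqType) (col : T -> I) : Prop :=
  forall i, (part Y col i = set0 \/ b <= #|part Y col i|%:R) /\
    non_edges e (part Y col i) <= d * #|part Y col i|%:R ^+ 2.

(** Near-cliques are split off greedily while the remainder [Y] is dense. Each takes at least a
    fraction [delta * alpha ^+ 2 / 4] of all vertices, which bounds the number of rounds. *)
Lemma near_clique_partition (T : finType) (e : rel T) (alpha delta : rat) (K : nat) :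
  symmetric e -> (0 < #|T|)%N -> 0 < alpha <= 1 -> 0 < delta <= 1 ->
  c4_count e < delta * (delta * alpha ^+ 2 / 2) ^+ 2 / 2 * #|T|%:R ^+ 4 ->
  1 <= delta * alpha ^+ 2 / 4 * K%:R ->
  exists (Y : {set T}) (col : T -> 'I_K.+1),
    edge_count e Y <= alpha * #|T|%:R ^+ 2 /\
    near_cliques e (delta * alpha ^+ 2 / 4 * #|T|%:R) delta Y col.
Proof.
move=> esym T0 ha hd hN hK; set b := delta * alpha ^+ 2 / 4.
set n : rat := #|T|%:R.
have n0 : 0 < n by rewrite ltr0n.
pose good (Y : {set T}) (col : T -> nat) j := (forall x, x \notin Y -> (col x < j)%N) /\ near_cliques e (b * n) delta Y col.
(* After [j] rounds either every round has extracted a near-clique, or the process has stopped with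
   a sparse remainder; the colours are below [j]. *)
have step j : (exists (Y : {set T}) col, good Y col j /\ #|Y|%:R <= n - j%:R * b * n) \/
    (exists (Y : {set T}) col, good Y col j /\ edge_count e Y <= alpha * n ^+ 2).
  elim: j => [|j [[Y [col [[cj gd] cY]]]|[Y [col [[cj gd] hY]]]]].
  - left; exists setT, (fun=> 0%N); rewrite cardsT !mul0r subr0; split => //; split.
      by move=> x; rewrite inE.
    have p0 i : part [set: T] (fun=> 0%N) i = set0 by apply/setP => x; rewrite !inE.
    move=> i; rewrite p0; split; first by left.
    by rewrite /non_edges big_set0 cards0 expr0n mulr0.
  - have [hY|hY] := lerP (edge_count e Y) (alpha * n ^+ 2).
      by right; exists Y, col; split => //; split => // x /cj /ltnW.
    have [X sXY [cX nX]] := near_clique esym T0 ha hd (ltW hY) hN; rewrite -/b in cX.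
    left; exists (Y :\: X), (fun x => if x \in X then j else col x).
    split; last first.
      have -> : #|Y :\: X|%:R = #|Y|%:R - #|X|%:R :> rat.
        by rewrite cardsDS // natrB // subset_leq_card.
      by rewrite -addn1 natrD; lra.
    split.
      move=> x; rewrite inE negb_and negbK; case: (x \in X) => //= xY.
      by apply: leq_trans (cj x xY) _.
    move=> i; have [->|ij] := eqVneq i j.
      suff -> : part (Y :\: X) (fun x => if x \in X then j else col x) j = X by split; [right|].
      apply/setP => x; rewrite !inE; case xX : (x \in X) => /=; first by rewrite eqxx.
      by apply/negP => /andP[xY /eqP cx]; have := cj x xY; rewrite cx ltnn.
    suff -> : part (Y :\: X) (fun x => if x \in X then j else col x) i = part Y col i by apply: gd.
    apply/setP => x; rewrite !inE; case xX : (x \in X) => //=.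
    by rewrite eq_sym (negPf ij) (subsetP sXY _ xX).
  - by right; exists Y, col; split => //; split => // x /cj /ltnW.
have {step} [Y [col [[cK gd] hY]]] : exists (Y : {set T}) col, good Y col K.+1 /\ edge_count e Y <= alpha * n ^+ 2.
  (* Without stopping, [K.+1] extractions would leave a negative number of vertices. *)
  case: (step K.+1) => // -[Y [col [_ cY]]]; exfalso.
  have b0 : 0 < b by case/andP: ha => a0 _; case/andP: hd => d0 _; rewrite /b !mulr_gt0 // exprn_gt0.
  have Y0 : 0 <= #|Y|%:R :> rat by rewrite ler0n.
  have h1 : n <= K%:R * b * n by rewrite ler_peMl ?(ltW n0) // mulrC.
  have h2 : 0 < b * n by rewrite mulr_gt0.
  by rewrite -addn1 natrD in cY; lra.
exists Y, (fun x => inord (col x)); split => // i.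
suff -> : part Y (fun x => inord (col x) : 'I_K.+1) i = part Y col i by apply: gd.
apply/setP => x; rewrite !inE; case xY : (x \in Y) => //=.
by rewrite -(inj_eq val_inj) /= inordK // cK // xY.
Qed.

(** * Pairs of near-cliques: adjacency governed by degrees *)

Definition row_diff (T : finType) (e : rel T) (Z : {set T}) (x y : T) : rat :=
  \sum_(z in Z) (e x z && ~~ e y z)%:R.

(** The degree into [Z], rounded down to a multiple of [|Z| / t]. The values run from 0 to [t];
    division by zero gives level 0 when [Z] is empty. *)
Definition level (T : finType) (e : rel T) (Z : {set T}) (t : nat) (x : T) : nat :=
  ((#|[set z in Z | e x z]| * t) %/ #|Z|)%N.

Lemma level_le (T : finType) (e : rel T) (Z : {set T}) (t : nat) (x : T) :
  (level e Z t x <= t)%N.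
Proof.
rewrite /level; have [->|Z0] := posnP #|Z|; first by rewrite divn0.
rewrite -{2}(mulKn t Z0) leq_div2r // leq_mul2r; apply/orP; right.
by apply/subset_leq_card/subsetP => z; rewrite inE => /andP[].
Qed.

Lemma row_diff_degree (T : finType) (e : rel T) (Z : {set T}) (x y : T) :
  row_diff e Z x y - row_diff e Z y x =
  #|[set z in Z | e x z]|%:R - #|[set z in Z | e y z]|%:R.
Proof.
rewrite /row_diff !card_indicator -!sumrB sum_in_indicator; apply: eq_bigr => z _.
rewrite !inE; case: (z \in Z); case: (e x z); case: (e y z) => /=; ring.
Qed.

Lemma row_diff_level (T : finType) (e : rel T) (Z : {set T}) (t : nat) (x y : T) :
  (0 < t)%N -> (0 < #|Z|)%N -> level e Z t x = level e Z t y ->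
  row_diff e Z x y - row_diff e Z y x <= #|Z|%:R / t%:R.
Proof.
move=> t0 Z0; rewrite /level row_diff_degree.
set a := #|[set z in Z | e x z]|; set b := #|[set z in Z | e y z]| => h.
have h1 : (a * t <= b * t + #|Z|)%N.
  have ha := divn_eq (a * t) #|Z|; have hb := divn_eq (b * t) #|Z|.
  have la := ltn_pmod (a * t) Z0; rewrite h in ha.
  by move: (b * t %/ #|Z|)%N (a * t %% #|Z|)%N (b * t %% #|Z|)%N ha hb la => *; lia.
rewrite ler_pdivlMr ?ltr0n // mulrBl lerBlDl.
by rewrite -!natrM -natrD ler_nat.
Qed.

Lemma row_diff_ge0 (T : finType) (e : rel T) (Z : {set T}) (x y : T) : 0 <= row_diff e Z x y.
Proof. by apply: sumr_ge0 => z _; rewrite ler0n. Qed.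

Lemma exists_le_average (I : finType) (F : I -> rat) (A : {pred I}) :
  0 < #|A|%:R :> rat -> exists2 i, i \in A & #|A|%:R * F i <= \sum_(j in A) F j.
Proof.
move=> A0; case: (boolP [exists i in A, #|A|%:R * F i <= \sum_(j in A) F j]).
  by case/exists_inP => i; exists i.
rewrite negb_exists_in => /forall_inP H; exfalso.
have [i iA] : exists i, i \in A by apply/card_gt0P; rewrite -(ltr0n rat).
have : \sum_(i in A) \sum_(j in A) F j < \sum_(i in A) #|A|%:R * F i.
  by apply: ltr_sum; [apply/hasP; exists i; rewrite ?mem_index_enum | move=> k kA; rewrite ltNge H].
by rewrite sum_const -mulr_sumr mulrC ltxx.
Qed.

(* If [x] sees [z] but not [z'], and [y] sees [z'] but not [z], then [x y z' z] is an
   induced C4 unless [xy] or [zz'] is a non-edge. *)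
Lemma row_diff_crossing (T : finType) (e : rel T) (X Z : {set T}) :
  symmetric e -> [disjoint X & Z] ->
  \sum_(x in X) \sum_(y in X) row_diff e Z x y * row_diff e Z y x <=
  c4_count e + non_edges e X * #|Z|%:R ^+ 2 + #|X|%:R ^+ 2 * non_edges e Z.
Proof.
move=> esym dXZ.
have XZ u v : u \in X -> v \in Z -> u != v.
  by move=> uX vZ; apply: contraTneq uX => ->; rewrite (disjointFl dXZ).
have -> : \sum_(x in X) \sum_(y in X) row_diff e Z x y * row_diff e Z y x =
    \sum_(x in X) \sum_(y in X) \sum_(z in Z) \sum_(z' in Z)
      ([&& e x z, ~~ e y z, e y z' & ~~ e x z'])%:R.
  apply: eq_bigr => x _; apply: eq_bigr => y _; rewrite /row_diff big_distrlr /=.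
  by apply: eq_bigr => z _; apply: eq_bigr => z2 _; rewrite -natrM mulnb -andbA.
have le_full (F : T -> rat) (A : {set T}) : (forall i, 0 <= F i) -> \sum_(i in A) F i <= \sum_i F i.
  move=> F0; rewrite [leRHS](bigID (mem A)) /= lerDl; exact: sumr_ge0.
have hc4 : \sum_(x in X) \sum_(y in X) \sum_(z in Z) \sum_(z' in Z) (c4 e x y z' z)%:R <= c4_count e.
  have s0 (F : T -> rat) (P : pred T) : (forall i, 0 <= F i) -> 0 <= \sum_(i | P i) F i by move=> F0; apply: sumr_ge0.
  rewrite /c4_count; apply: (le_trans (le_full (fun x => \sum_(y in X) _) _ _)) => [x|]; first by do 3 (apply/s0 => ?).
  apply: ler_sum => x _.
  apply: (le_trans (le_full (fun y => \sum_(z in Z) _) _ _)) => [y|]; first by do 2 (apply/s0 => ?).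
  apply: ler_sum => y _; rewrite [leRHS]exchange_big.
  apply: (le_trans (le_full (fun z => \sum_(z' in Z) _) _ _)) => [z|]; first by apply/s0 => ?.
  by apply: ler_sum => z _; apply: le_full.
have hX : non_edges e X * #|Z|%:R ^+ 2 = \sum_(x in X) \sum_(y in X) \sum_(z in Z) \sum_(z' in Z) (na e x y)%:R.
  rewrite /non_edges mulr_suml; apply: eq_bigr => x _; rewrite mulr_suml; apply: eq_bigr => y _.
  by rewrite !sum_const -mulrA.
have hZ : #|X|%:R ^+ 2 * non_edges e Z = \sum_(x in X) \sum_(y in X) \sum_(z in Z) \sum_(z' in Z) (na e z z')%:R.
  by rewrite !sum_const -mulrA mulrC.
rewrite hX hZ; apply: le_trans (lerD (lerD hc4 (lexx _)) (lexx _)).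
rewrite -!big_split; apply: ler_sum => x xX; rewrite -!big_split; apply: ler_sum => y yX.
rewrite -!big_split; apply: ler_sum => z zZ; rewrite -!big_split; apply: ler_sum => z' zZ' /=.
(* Vertices of the disjoint sets [X] and [Z] differ; if [x = y] or [z = z'], the conditions on the
   left conflict. *)
rewrite -!natrD ler_nat /c4 /na (XZ _ _ xX zZ') (XZ _ _ yX zZ) (esym z' z) (esym z x) /=.
have [->|_] := eqVneq x y; first by case: (e y z).
have [->|_] := eqVneq z z'; first by case: (e x z'); rewrite ?andbF.
by case: (e x z); case: (e y z); case: (e y z'); case: (e x z'); case: (e x y); case: (e z z').
Qed.

Lemma sum_agree_row_diff (T : finType) (e : rel T) (Z : {set T}) (x y : T) :
  \sum_(z in Z) (e x z != e y z)%:R = row_diff e Z x y + row_diff e Z y x.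
Proof.
rewrite /row_diff -big_split; apply: eq_bigr => z _ /=.
by case: (e x z); case: (e y z); rewrite ?addr0 ?add0r.
Qed.

(** For [p <= q], closeness gives [g * (p + q) <= 2 * g * p + g ^+ 2], and [2 * g * p <= p ^+ 2 + g
    ^+ 2 <= p * q + g ^+ 2]. *)
Lemma add_le_mul_of_close (g p q : rat) : 0 <= g -> 0 <= p -> 0 <= q ->
  p - q <= g -> q - p <= g -> g * (p + q) <= 2 * g ^+ 2 + p * q.
Proof.
move=> g0; wlog le_pq : p q / p <= q => [hw p0 q0 h1 h2|].
  by case: (leP p q) => [|/ltW] hle; [|rewrite addrC (mulrC p)]; apply: hw.
move=> p0 q0 _ h.
have h1 : g * (q - p) <= g * g by apply: ler_wpM2l.
have h2 : p * p <= p * q by apply: ler_wpM2l.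
have := sqr_ge0 (p - g).
have -> : (p - g) ^+ 2 = p * p - 2 * (g * p) + g * g by ring.
rewrite expr2 mulrDr; rewrite mulrBr in h1; lra.
Qed.

(* The crossing bound turns [p q] into copies of [C4], while the degrees of
   vertices of one level differ by at most [g], whence [p + q <= 2 g + p q / g]. *)
Lemma level_predictor (T : finType) (e : rel T) (X Z : {set T}) (t s : nat) (d : rat) :
  symmetric e -> [disjoint X & Z] -> (2 < t)%N -> d = t%:R ^- 6 ->
  non_edges e X <= d * #|X|%:R ^+ 2 -> non_edges e Z <= d * #|Z|%:R ^+ 2 ->
  c4_count e <= d * (#|X|%:R ^+ 2 * #|Z|%:R ^+ 2) ->
  exists w : pred T,
    \sum_(x in X | level e Z t x == s) \sum_(z in Z) (e x z != w z)%:R <=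
    2 / t%:R ^+ 2 * (#|X|%:R * #|Z|%:R : rat)
    + 2 / t%:R * (#|[set x in X | level e Z t x == s]|%:R * #|Z|%:R).
Proof.
move=> esym dXZ t2 hd hX hZ hN.
set A := [set x in X | level e Z t x == s].
have t0 : 0 < t%:R :> rat by rewrite ltr0n; apply: leq_trans t2.
have AX : A \subset X by apply/subsetP => x; rewrite inE => /andP[].
have eqA F : \sum_(x in X | level e Z t x == s) F x = \sum_(x in A) F x :> rat.
  by apply: eq_bigl => x; rewrite inE.
set x_ : rat := #|X|%:R; set z_ : rat := #|Z|%:R; set a_ : rat := #|A|%:R.
have x0 : 0 <= x_ by rewrite ler0n.
have z0 : 0 <= z_ by rewrite ler0n.
have a0 : 0 <= a_ by rewrite ler0n.
have ti0 : 0 < t%:R^-1 :> rat by rewrite invr_gt0.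
set h := t%:R^-1 in ti0 *.
have h0 : 0 <= h by apply: ltW.
have -> : 2 / t%:R ^+ 2 = 2 * h ^+ 2 :> rat by rewrite exprVn.
have hd' : d = h ^+ 6 by rewrite exprVn.
have h3 : 3 * h <= 1 by rewrite ler_pdivrMr // mul1r ler_nat.
have R0 : 0 <= 2 * h ^+ 2 * (x_ * z_) by rewrite !mulr_ge0.
have R1 : 0 <= 2 * h * (a_ * z_) by rewrite !mulr_ge0 ?(ltW ti0) //.
have triv (w : pred T) : \sum_(x in X | level e Z t x == s) \sum_(z in Z) (e x z != w z)%:R <= a_ * z_.
  rewrite eqA; apply: (@le_trans _ _ (\sum_(x in A) \sum_(z in Z) 1)).
    by apply: ler_sum => x _; apply: ler_sum => z _; rewrite lern1 leq_b1.
  by rewrite !sum_const mul1r mulrC.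
(* A small level set may be predicted arbitrarily: all its pairs fit into the first error term. *)
have [az|az] := leP a_ (2 * h ^+ 2 * x_).
  exists pred0; apply: (le_trans (triv _)).
  have : a_ * z_ <= 2 * h ^+ 2 * x_ * z_ by apply: ler_wpM2r.
  have -> : 2 * h ^+ 2 * x_ * z_ = 2 * h ^+ 2 * (x_ * z_) by ring.
  lra.
have ap : 0 < a_ by apply: le_lt_trans az; rewrite !mulr_ge0 ?sqr_ge0 //.
have [Z0|Z0] := posnP #|Z|.
  exists pred0; apply: (le_trans (triv _)).
  by rewrite /z_ Z0 !mulr0 addr0.
have zp : 0 < z_ by rewrite ltr0n.
set g := z_ * h.
have gp : 0 < g by rewrite mulr_gt0.
pose pq x y := row_diff e Z x y + row_diff e Z y x.
have hpq x y : x \in A -> y \in A -> g * pq x y <= 2 * g ^+ 2 + row_diff e Z x y * row_diff e Z y x.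
  rewrite !inE => /andP[_ /eqP lx] /andP[_ /eqP ly].
  have tp : (0 < t)%N by apply: leq_trans t2.
  have d1 := row_diff_level tp Z0 (etrans lx (Logic.eq_sym ly)).
  have d2 := row_diff_level tp Z0 (etrans ly (Logic.eq_sym lx)).
  by apply: add_le_mul_of_close d1 d2; rewrite ?row_diff_ge0 // ltW.
have M : g * \sum_(x in A) \sum_(y in A) pq x y <= 2 * g ^+ 2 * a_ ^+ 2 + 3 * d * (x_ ^+ 2 * z_ ^+ 2).
  apply: (@le_trans _ _ (\sum_(x in A) \sum_(y in A) (2 * g ^+ 2 + row_diff e Z x y * row_diff e Z y x))).
    rewrite mulr_sumr; apply: ler_sum => x xA; rewrite mulr_sumr.
    by apply: ler_sum => y yA; apply: hpq.
  under eq_bigr do rewrite big_split sum_const.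
  rewrite big_split /= sum_const -/a_ -(mulrA (2 * _)) -expr2 lerD2l.
  have sub : \sum_(x in A) \sum_(y in A) row_diff e Z x y * row_diff e Z y x <=
      \sum_(x in X) \sum_(y in X) row_diff e Z x y * row_diff e Z y x.
    have p0 u v : 0 <= row_diff e Z u v * row_diff e Z v u by rewrite mulr_ge0 ?row_diff_ge0.
    apply: (@le_trans _ _ (\sum_(x in A) \sum_(y in X) row_diff e Z x y * row_diff e Z y x)).
      by apply: ler_sum => x _; apply: ler_sum_subset.
    by apply: ler_sum_subset => // x; apply: sumr_ge0.
  apply: (le_trans sub); apply: (le_trans (row_diff_crossing esym dXZ)).
  have q1 : non_edges e X * z_ ^+ 2 <= d * x_ ^+ 2 * z_ ^+ 2 by rewrite ler_wpM2r ?sqr_ge0.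
  have q2 : x_ ^+ 2 * non_edges e Z <= x_ ^+ 2 * (d * z_ ^+ 2) by rewrite ler_wpM2l ?sqr_ge0.
  rewrite -/z_ -/x_ in hN *; lra.
(* The row of a vertex [y] with at most average disagreement serves as predictor. *)
have [y yA hy] : exists2 y, y \in A & a_ * \sum_(x in A) pq x y <= \sum_(x in A) \sum_(y in A) pq x y.
  have [y yA hy] := exists_le_average (fun y => \sum_(x in A) pq x y) ap.
  by exists y; rewrite // [leRHS]exchange_big.
exists (e y); rewrite eqA.
under eq_bigr do rewrite sum_agree_row_diff -/(pq _ _).
set S := \sum_(x in A) pq x y in hy *.
have B : g * (a_ * S) <= 2 * g ^+ 2 * a_ ^+ 2 + 3 * d * (x_ ^+ 2 * z_ ^+ 2).
  by apply: le_trans M; rewrite ler_pM2l.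
rewrite -(ler_pM2l (mulr_gt0 gp ap)) -mulrA; apply: (le_trans B).
have -> : g * a_ * (2 * h ^+ 2 * (x_ * z_) + 2 * h * (a_ * z_)) =
  2 * g ^+ 2 * a_ ^+ 2 + 2 * h ^+ 3 * (x_ * z_ ^+ 2) * a_ by rewrite /g; ring.
rewrite lerD2l.
(* Since [a_] exceeds [2 * h ^+ 2 * x_], the first error term, multiplied by [g * a_], dominates the
   crossing term [3 * d * (x_ ^+ 2 * z_ ^+ 2)]. *)
have : 2 * h ^+ 3 * (x_ * z_ ^+ 2) * (2 * h ^+ 2 * x_) <= 2 * h ^+ 3 * (x_ * z_ ^+ 2) * a_.
  by apply: ler_wpM2l; [rewrite !mulr_ge0 ?exprn_ge0 | exact: ltW].
apply: le_trans; rewrite hd'.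
have -> : 2 * h ^+ 3 * (x_ * z_ ^+ 2) * (2 * h ^+ 2 * x_) = 4 * (h ^+ 5 * (x_ ^+ 2 * z_ ^+ 2)) by ring.
have -> : 3 * h ^+ 6 * (x_ ^+ 2 * z_ ^+ 2) = (3 * h) * (h ^+ 5 * (x_ ^+ 2 * z_ ^+ 2)) by ring.
by apply: ler_wpM2r; [rewrite !mulr_ge0 ?exprn_ge0 | lra].
Qed.

(** * Degree profiles over all parts *)

Lemma sum_parts (T : finType) (Y : {set T}) (I : finType) (col : T -> I) (F : T -> rat) :
  \sum_(x in ~: Y) F x = \sum_i \sum_(x in part Y col i) F x.
Proof.
rewrite (partition_big col xpredT) //=; apply: eq_bigr => i _.
by apply: eq_bigl => x; rewrite !inE.
Qed.

(** These are the exponentially many classes: the part of [x] with its level towards every part. *)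
Definition degree_profile (T : finType) (e : rel T) (Y : {set T}) (I : finType)
    (col : T -> I) (t : nat) (x : T) : I * {ffun I -> 'I_t.+1} :=
  (col x, [ffun j => inord (level e (part Y col j) t x)]).

(** Up to few errors, the class of [x] alone decides its adjacencies outside [Y]. The condition that
    [w] holds at [x] itself will justify turning classes into cliques. *)
Lemma profile_predictor (T : finType) (e : rel T) (Y : {set T}) (I : finType)
    (col : T -> I) (t : nat) (b : rat) :
  symmetric e -> (2 < t)%N -> 0 <= b ->
  near_cliques e b (t%:R ^- 6) Y col -> c4_count e <= t%:R ^- 6 * b ^+ 4 ->
  exists w : I * {ffun I -> 'I_t.+1} -> pred T,
    (forall x, w (degree_profile e Y col t x) x) /\
    \sum_(x in ~: Y) \sum_(y in ~: Y)
       ((x != y) && (e x y != w (degree_profile e Y col t x) y))%:R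
    <= 5 / t%:R * #|T|%:R ^+ 2 :> rat.
Proof.
move=> esym t2 b0 nc hN; set X := part Y col in nc *.
have tp : 0 < t%:R :> rat by rewrite ltr0n; apply: leq_trans t2.
set h : rat := t%:R^-1; have h0 : 0 <= h by rewrite invr_ge0 ltW.
have h3 : 3 * h <= 1 by rewrite ler_pdivrMr // mul1r ler_nat.
have dXX i j : i != j -> [disjoint X i & X j].
  move=> ij; rewrite -setI_eq0; apply/eqP/setP => x; rewrite !inE.
  by apply/negP => /andP[/andP[_ /eqP ->] /andP[_]]; rewrite (negPf ij).
have ex (p : I * I * 'I_t.+1) : exists w : pred T, p.1.1 != p.1.2 ->
    \sum_(x in X p.1.1 | level e (X p.1.2) t x == p.2) \sum_(z in X p.1.2) (e x z != w z)%:R <=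
    2 / t%:R ^+ 2 * (#|X p.1.1|%:R * #|X p.1.2|%:R : rat)
    + 2 / t%:R * (#|[set x in X p.1.1 | level e (X p.1.2) t x == p.2]|%:R * #|X p.1.2|%:R).
  case: p => [[i j] s] /=; have [->|ij] := eqVneq i j; first by exists pred0.
  have R0 : 0 <= 2 / t%:R ^+ 2 * (#|X i|%:R * #|X j|%:R : rat)
    + 2 / t%:R * (#|[set x in X i | level e (X j) t x == s]|%:R * #|X j|%:R).
    by rewrite addr_ge0 ?mulr_ge0 ?invr_ge0 ?exprn_ge0 ?ler0n.
  have [[hi|hi] ni] := nc i; first by exists pred0 => _; rewrite big1 // => x; rewrite /X hi inE.
  have [[hj|hj] nj] := nc j; first by exists pred0 => _; rewrite big1 // => x; rewrite /X hj big_set0.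
  have [|w hw] := level_predictor s esym (dXX i j ij) t2 erefl ni nj; last by exists w.
  (* Both parts have at least [b] vertices here, so [b ^+ 4] is at most the product of their squared
     sizes. *)
  apply: (le_trans hN); apply: ler_wpM2l; first by rewrite invr_ge0 exprn_ge0 // ltW.
  have -> : b ^+ 4 = b ^+ 2 * b ^+ 2 by rewrite -exprD.
  by apply: ler_pM; rewrite ?sqr_ge0 // ler_pXn2r ?nnegrE ?ler0n.
have [u hu] := fin_all_exists ex.
(* Within a part, being a near-clique, every pair is predicted adjacent; towards another part the
   level selects the predictor. *)
pose w (l : I * {ffun I -> 'I_t.+1}) : pred T :=
  fun y => (col y == l.1) || u (l.1, col y, l.2 (col y)) y.
exists w; split; first by move=> x; rewrite /w /= eqxx.
under eq_bigr do rewrite (sum_parts _ col).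
rewrite (sum_parts _ col) -/X.
have pair i j : \sum_(x in X i) \sum_(y in X j)
    ((x != y) && (e x y != w (degree_profile e Y col t x) y))%:R <= 5 * h * (#|X i|%:R * #|X j|%:R).
  have [<-|ij] := eqVneq i j.
    have [_ ni] := nc i.
    apply: (@le_trans _ _ (non_edges e (X i))).
      apply: ler_sum => x; rewrite inE => /andP[_ /eqP cx].
      apply: ler_sum => y; rewrite inE => /andP[_ /eqP cy].
      by rewrite ler_nat /w /= cx cy eqxx /na; case: (e x y); case: (x != y).
    apply: (le_trans ni); rewrite expr2 ler_wpM2r ?mulr_ge0 ?ler0n //.
    rewrite -exprVn -/h exprS; apply: (@le_trans _ _ (h * 1)); last by lra.
    by apply: ler_wpM2l => //; apply: exprn_ile1 => //; lra.
  apply: (@le_trans _ _ (\sum_(s < t.+1) \sum_(x in X i | level e (X j) t x == s)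
      \sum_(z in X j) (e x z != u (i, j, s) z)%:R)).
    rewrite (partition_big (fun x => inord (level e (X j) t x) : 'I_t.+1) xpredT) //=.
    apply: ler_sum => s _.
    rewrite (eq_bigl (fun x => (x \in X i) && (level e (X j) t x == s))); last first.
      by move=> x; rewrite -(inj_eq val_inj) /= inordK // ltnS level_le.
    apply: ler_sum => x /andP[]; rewrite inE => /andP[_ /eqP cx] /eqP lx.
    apply: ler_sum => y; rewrite inE => /andP[_ /eqP cy].
    rewrite ler_nat /w /= cx cy ffunE -/(X j) (eq_sym j i) (negPf ij) /= lx inord_val.
    by case: (x != y).
  (* Summed over the [t.+1] levels, the two error terms contribute [2 * h + 2 * h ^+ 2] and [2 * h],
     together at most [5 * h]. *)
  apply: (le_trans (ler_sum _ (fun s _ => hu (i, j, s) ij))).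
  rewrite /= big_split /= sum_const card_ord -mulr_sumr -mulr_suml.
  have -> : \sum_(s < t.+1) #|[set x in X i | level e (X j) t x == s]|%:R = #|X i|%:R :> rat.
    rewrite -[in RHS]sum1_card natr_sum (partition_big (fun x => inord (level e (X j) t x) : 'I_t.+1) xpredT) //=.
    apply: eq_bigr => s _; rewrite -sum1_card natr_sum; apply: eq_bigl => x.
    by rewrite inE -(inj_eq val_inj) /= inordK // ltnS level_le.
  rewrite -exprVn -/h -[t.+1]addn1 natrD.
  have th : h * t%:R = 1 by rewrite mulVf // gt_eqF.
  set xz : rat := _ * #|X j|%:R.
  have xz0 : 0 <= xz by rewrite mulr_ge0 ?ler0n.
  have -> : 2 * h ^+ 2 * xz * (t%:R + 1) + 2 * h * xz = (2 * h * (h * t%:R) + 2 * h ^+ 2 + 2 * h) * xz by ring.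
  rewrite th mulr1; apply: ler_wpM2r => //.
  have : h * (3 * h) <= h * 1 by apply: ler_wpM2l.
  rewrite expr2; lra.
apply: (@le_trans _ _ (\sum_i \sum_j 5 * h * (#|X i|%:R * #|X j|%:R))).
  apply: ler_sum => i _; rewrite exchange_big; apply: ler_sum => j _; exact: pair.
under eq_bigr do rewrite -mulr_sumr -mulr_sumr.
rewrite -mulr_sumr -mulr_suml -expr2 -/h.
apply: ler_wpM2l; first by rewrite mulr_ge0.
rewrite ler_pXn2r ?nnegrE ?ler0n ?sumr_ge0 //.
have -> : \sum_i #|X i|%:R = #|~: Y|%:R :> rat.
  rewrite -sum1_card natr_sum (sum_parts _ col); apply: eq_bigr => i _.
  by rewrite -sum1_card natr_sum.
by rewrite ler_nat max_card.
Qed.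

(** * Random choice of one representative per class *)

Section Representatives.
Variables (T L : finType) (F : L -> {set T}).

(** For [f] uniform in the product of the [F l], its values on [J] are independent, so pinning them
    has probability at most [1 / \prod_(l in J) #|F l|]; denominators are cleared. *)
Lemma card_pinned_family (J : {set L}) (g : L -> T) :
  (\prod_(l in J) #|F l| * #|[set f : {ffun L -> T} | (f \in family F) && [forall l in J, f l == g l]]|
   <= #|family F|)%N.
Proof.
case: (boolP [forall l in J, g l \in F l]) => [/forall_inP gF|]; last first.
  rewrite negb_forall_in => /exists_inP[l lJ gl].
  rewrite (_ : [set f | _] = set0) ?cards0 ?muln0 //.
  apply/setP => f; rewrite !inE; apply/negP => /andP[/familyP ff /forall_inP /(_ _ lJ) /eqP fl].
  by move: (ff l); rewrite fl (negPf gl).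
(* Pinning shrinks the factors indexed by [J] to single points. *)
pose F' l := if l \in J then [set g l] else F l.
have -> : #|[set f : {ffun L -> T} | (f \in family F) && [forall l in J, f l == g l]]| = #|family F'|.
  apply: eq_card => f; rewrite !inE; apply/andP/familyP.
    move=> [/familyP ff /forall_inP fJ] l; rewrite /F'; case: ifP => lJ; last exact: ff.
    by rewrite inE fJ.
  move=> ff; split.
    apply/familyP => l; move: (ff l); rewrite /F'; case: ifP => // lJ.
    by rewrite inE => /eqP ->; apply: gF.
  by apply/forall_inP => l lJ; move: (ff l); rewrite /F' lJ inE.
rewrite !card_family !foldrE !big_image /=.
have -> : (\prod_i #|F' i| = \prod_(i | i \notin J) #|F i|)%N.
  rewrite (bigID (mem J)) /= big1 => [|l lJ]; last by rewrite /F' lJ cards1.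
  by rewrite mul1n; apply: eq_bigr => l; rewrite /F' => /negPf ->.
by rewrite [leqRHS](bigID (mem J)).
Qed.

Let W : rat := #|family F|%:R.
Let Fam : pred {ffun L -> T} := [pred f | f \in family F].

(** With denominators cleared, the expectation of [G (f a)] is bounded by the mean of [G] over
    [F a]; [W] is the size of the sample space. *)
Lemma sum_one_representative (a : L) (G : T -> rat) : (forall x, 0 <= G x) ->
  #|F a|%:R * \sum_(f | Fam f) G (f a) <= W * \sum_(x in F a) G x.
Proof.
move=> G0; rewrite (partition_big (fun f : {ffun L -> T} => f a) (mem (F a))) /=; last first.
  by move=> f /familyP /(_ a).
rewrite !mulr_sumr; apply: ler_sum => x xa.
rewrite (eq_bigr (fun=> G x)) => [|f /andP[_ /eqP ->] //].
rewrite sum_const_pred [_ * #|_|%:R]mulrC mulrA; apply: ler_wpM2r => //.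
rewrite -natrM ler_nat; have := card_pinned_family [set a] (fun=> x).
rewrite big_set1; apply: leq_trans; rewrite leq_mul2l; apply/orP; right.
apply/subset_leq_card/subsetP => f; rewrite unfold_in => /andP[ff /eqP fa].
rewrite inE; apply/andP; split=> //.
by apply/forall_inP => l; rewrite inE => /eqP ->; rewrite fa.
Qed.

(** Representatives of distinct classes are independent. *)
Lemma sum_two_representatives (a b : L) (G : T -> T -> rat) : a != b ->
  (forall x y, 0 <= G x y) ->
  #|F a|%:R * #|F b|%:R * \sum_(f | Fam f) G (f a) (f b)
  <= W * \sum_(x in F a) \sum_(y in F b) G x y.
Proof.
move=> ab G0; rewrite (partition_big (fun f : {ffun L -> T} => f a) (mem (F a))) /=; last first.
  by move=> f /familyP /(_ a).
rewrite !mulr_sumr; apply: ler_sum => x xa.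
rewrite (partition_big (fun f : {ffun L -> T} => f b) (mem (F b))) /=; last first.
  by move=> f /andP[/familyP /(_ b)].
rewrite !mulr_sumr; apply: ler_sum => y yb.
rewrite (eq_bigr (fun=> G x y)) => [|f /andP[/andP[_ /eqP ->] /eqP ->] //].
rewrite sum_const_pred [G x y * _]mulrC mulrA; apply: ler_wpM2r => //.
rewrite -!natrM ler_nat; have := card_pinned_family [set a; b] (fun l => if l == a then x else y).
rewrite big_setU1 ?inE // big_set1; apply: leq_trans; rewrite leq_mul2l; apply/orP; right.
apply/subset_leq_card/subsetP => f; rewrite unfold_in => /andP[/andP[ff /eqP fa] /eqP fb].
rewrite inE; apply/andP; split=> //.
apply/forall_inP => l; rewrite !inE => /orP[] /eqP ->; rewrite ?eqxx ?fa //.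
by rewrite ifN 1?eq_sym // fb.
Qed.

(** A 4-cycle on representatives needs four distinct classes, whose independent representatives hit
    a given quadruple with probability at most [tau ^- 4]. *)
Lemma sum_c4_representatives (e : rel T) (a b c d : L) (tau : rat) :
  irreflexive e -> 0 <= tau -> (forall l, tau <= #|F l|%:R) ->
  tau ^+ 4 * \sum_(f | Fam f) (c4 e (f a) (f b) (f c) (f d))%:R <= W * c4_count e.
Proof.
move=> eirr tau0 tauF.
pose R := (\sum_(f | Fam f) \sum_x \sum_y \sum_z \sum_v
  ((c4 e x y z v)%:R * [&& f a == x, f b == y, f c == z & f d == v]%:R) : rat).
have -> : \sum_(f | Fam f) (c4 e (f a) (f b) (f c) (f d))%:R = R.
  apply: eq_bigr => f _.
  rewrite (bigD1 (f a)) //= [X in _ + X]big1 ?addr0 => [|x]; last first.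
    rewrite eq_sym => /negPf ->; rewrite big1 // => y _; rewrite big1 // => z _.
    by rewrite big1 // => v _; rewrite mulr0.
  rewrite (bigD1 (f b)) //= [X in _ + X]big1 ?addr0 => [|x]; last first.
    rewrite eq_sym => /negPf ->; rewrite eqxx /= big1 // => z _.
    by rewrite big1 // => v _; rewrite mulr0.
  rewrite (bigD1 (f c)) //= [X in _ + X]big1 ?addr0 => [|x]; last first.
    rewrite eq_sym => /negPf ->; rewrite !eqxx /= big1 // => z _.
    by rewrite mulr0.
  rewrite (bigD1 (f d)) //= [X in _ + X]big1 ?addr0 => [|x]; last first.
    by rewrite eq_sym => /negPf ->; rewrite !eqxx /= mulr0.
  by rewrite !eqxx mulr1.
rewrite /R; rewrite exchange_big /c4_count !mulr_sumr; apply: ler_sum => x _.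
rewrite exchange_big !mulr_sumr; apply: ler_sum => y _.
rewrite exchange_big !mulr_sumr; apply: ler_sum => z _.
rewrite exchange_big !mulr_sumr; apply: ler_sum => v _ /=.
case hc: (c4 e x y z v); last by rewrite big1 ?mulr0 // => f _; rewrite mul0r.
rewrite mulr1.
under eq_bigr do rewrite mul1r.
case: (boolP [&& a != b, a != c, a != d, b != c, b != d & c != d]); last first.
  move=> nd; rewrite big1 ?mulr0 // => f _; apply/eqP; rewrite pnatr_eq0 eqb0.
  apply: contra nd => /and4P[/eqP fa /eqP fb /eqP fc /eqP fd].
  move: hc; rewrite /c4 /na -fa -fb -fc -fd => /and5P[h1 h2 h3 h4 /andP[/andP[h5 _] /andP[h6 _]]].
  by do 5?[apply/andP; split]; apply/negP => /eqP E; move: h1 h2 h3 h4 h5 h6; rewrite E ?eirr ?eqxx.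
case/and5P => ab ac ad bc /andP[bd cd].
pose g l := if l == a then x else if l == b then y else if l == c then z else v.
pose J := [set a; b; c; d].
have tauJ : tau ^+ 4 <= (\prod_(l in J) #|F l|)%:R.
  rewrite natr_prod; have <- : \prod_(l in J) tau = tau ^+ 4.
    rewrite prodr_const; congr (_ ^+ _); rewrite /J -!setUA !cardsU1 cards1 !inE.
    by rewrite (negPf ab) (negPf ac) (negPf ad) (negPf bc) (negPf bd) (negPf cd).
  by apply: ler_prod => l _; rewrite tau0 tauF.
have := card_pinned_family J g; rewrite -(ler_nat rat) natrM; apply: le_trans.
apply: ler_pM => //; rewrite ?exprn_ge0 ?sumr_ge0 //.
rewrite -natr_sum ler_nat -sum1_card big_mkcond [leqRHS]big_mkcond.
apply: leq_sum => f _; rewrite in_set.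
have [ff|//] := boolP (Fam f); rewrite (ff : f \in family F) /=.
have [/and4P[/eqP fa /eqP fb /eqP fc /eqP fd]|_] := boolP [&& _, _, _ & _] => //.

rewrite (_ : [forall l in J, f l == g l]) //.
apply/forall_inP => l; rewrite !inE /g -!orbA.
case/or4P => /eqP ->; rewrite ?eqxx ?fa //.
- by rewrite (eq_sym b) (negPf ab) fb.
- by rewrite (eq_sym c) (negPf ac) (eq_sym c) (negPf bc) fc.
- by rewrite (eq_sym d) (negPf ad) (eq_sym d) (negPf bd) (eq_sym d) (negPf cd) fd.
Qed.

End Representatives.

(** * Blow-up of the graph on the representatives *)

Section Approximation.
Variables (T L : finType) (e : rel T) (X : {set T}) (cl : T -> L) (w : L -> pred T).
Hypotheses (esym : symmetric e) (eirr : irreflexive e).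
Hypothesis wcl : forall x, w (cl x) x.

Let V l := [set x in X | cl x == l].
Let D x y : rat := ((x != y) && (e x y != w (cl x) y))%:R.

Definition blowup (big : pred L) (f : L -> T) : rel T := fun x y =>
  [&& x \in X, y \in X, x != y, big (cl x), big (cl y)
    & (cl x == cl y) || e (f (cl x)) (f (cl y))].

(** Vertices of one large class are adjacent twins, so consecutive vertices of an induced 4-cycle
    lie in distinct classes, and opposite ones do because they are non-adjacent. The representatives
    then form an induced 4-cycle. *)
Lemma blowup_c4_free (big : pred L) (f : L -> T) :
  (forall l, big l -> f l \in V l) ->
  (forall a b c d, ~~ c4 e (f a) (f b) (f c) (f d)) ->
  forall a b c d, ~~ c4 (blowup big f) a b c d.
Proof.
move=> fV fc4 x y z v; apply/negP; rewrite /c4 /na.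
case/and5P => h1 h2 h3 h4 /andP[/andP[xz h5] /andP[yv h6]].
have finj l l' : big l -> big l' -> f l = f l' -> l = l'.
  move=> /fV; rewrite inE => /andP[_ /eqP E1] /fV; rewrite inE => /andP[_ /eqP E2] E.
  by rewrite -E1 -E2 E.
move: h1 h2 h3 h4 h5 h6; rewrite /blowup.
case/and5P => Xx Xy xy bx /andP[by_ e1].
case/and5P => _ Xz yz _ /andP[bz e2].
case/and5P => _ Xv zv _ /andP[bv e3].
case/and5P => _ _ vx _ /andP[_ e4].
rewrite Xx Xy Xz Xv xz yv bx by_ bz bv /= !negb_or => /andP[n1 m1] /andP[n2 m2].
move: e1 e2 e3 e4 n1 m1 n2 m2 bx by_ bz bv.
move: (cl x) (cl y) (cl z) (cl v) => a b c d e1 e2 e3 e4 n1 m1 n2 m2 ba bb bc bd.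
have ab : a != b.
  apply: contraNneq (n1) => ab; move: e4 e2; rewrite ab eq_sym (negPf n2) /= => e4.
  by move: m2; rewrite esym e4.
have bc' : b != c.
  apply: contraNneq (n2) => bc'; move: e1; rewrite bc' (negPf n1) /= => e1.
  by move: m1; rewrite e1.
have cd : c != d.
  apply: contraNneq (n1) => cd; move: e2; rewrite cd (negPf n2) /= => e2.
  by move: m2; rewrite e2.
have da : d != a.
  apply: contraNneq (n1) => da; move: e3; rewrite da eq_sym (negPf n1) /= => e3.
  by move: m1; rewrite esym e3.
move: e1 e2 e3 e4.
rewrite (negPf ab) (negPf bc') (negPf cd) (negPf da) /= => e1 e2 e3 e4.
move/negP: (fc4 a b c d); apply; rewrite /c4 /na e1 e2 e3 e4 m1 m2 !andbT /=.
apply/andP; split; apply/eqP => /finj E; [move: n1|move: n2]; rewrite E ?eqxx //.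
Qed.

(** For distinct large classes, [e x y], [w (cl x) y], [e (f (cl x)) y], [w (cl y) (f (cl x))] and
    [e (f (cl y)) (f (cl x))] are compared in turn; each disagreement is one value of [D]. *)
Lemma blowup_cost (big : pred L) (f : L -> T) x y :
  (forall l, big l -> f l \in V l) -> x \in X -> y \in X ->
  (e x y != blowup big f x y)%:R <=
  (~~ big (cl x))%:R + (~~ big (cl y))%:R + D x y
  + (big (cl x))%:R * (D (f (cl x)) y + D y (f (cl x)))
  + ([&& big (cl x), big (cl y) & cl x != cl y])%:R * D (f (cl y)) (f (cl x)).
Proof.
move=> fV xX yX.
have D0 u v : 0 <= D u v by rewrite ler0n.
rewrite /blowup xX yX /=.
have [->|xy] := eqVneq x y.
  by rewrite eirr eqxx /= !addr_ge0 ?mulr_ge0 ?addr_ge0 ?ler0n.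
case: (boolP (big (cl x))) => bx; last first.
  rewrite /= !mul0r !addr0 -addrA; apply: (@le_trans _ _ 1); first by rewrite lern1 leq_b1.
  by rewrite lerDl addr_ge0 ?ler0n.
case: (boolP (big (cl y))) => by_; last first.
  rewrite /= mul0r addr0 add0r mul1r -addrA.
  apply: (@le_trans _ _ 1); first by rewrite lern1 leq_b1.
  by rewrite lerDl !addr_ge0 ?ler0n.
have [cxy|cxy] /= := eqVneq (cl x) (cl y).
  (* In a common class [wcl] predicts adjacency, so a non-edge is a prediction error. *)
  rewrite mul0r mul1r !add0r addr0; apply: (@le_trans _ _ (D x y)).
    by rewrite /D xy cxy wcl.
  by rewrite lerDl addr_ge0.
move: (fV _ bx) (fV _ by_); rewrite !inE => /andP[_ /eqP fx] /andP[_ /eqP fy].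
have xfy : f (cl x) != y by apply: contraNneq cxy => <-; rewrite fx.
have fxy : f (cl y) != f (cl x) by apply: contraNneq cxy => E; rewrite -fx -E fy.
rewrite /D fx fy xy xfy (eq_sym y) xfy fxy /= !mul1r !add0r -!natrD ler_nat.
rewrite (esym y) (esym (f (cl y))).
by case: (e x y); case: (e _ _); case: (w _ _); case: (e _ _); case: (w _ _).
Qed.

Variables (err h : rat).
Let n : rat := #|T|%:R.
Let m : rat := #|L|%:R.
Hypotheses (T0 : (0 < #|T|)%N) (h0 : 0 < h) (h1 : h <= 1).
Hypothesis herr : \sum_(x in X) \sum_(y in X) D x y <= err.
Hypothesis hc4 : c4_count e * m ^+ 8 <= h ^+ 5 * n ^+ 4.

(** The classes below this size, at most [m] in number, hold at most [h * n] vertices together. *)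
Let tau := h * n / m.
Let big l := tau <= #|V l|%:R.
(* Small classes are dropped from the blow-up; letting their representatives be
   arbitrary keeps every factor of the sample space large. *)
Let F l := if big l then V l else setT.
Let W : rat := #|family F|%:R.
Let Fam : pred {ffun L -> T} := [pred f | f \in family F].

Let sum_class (G : T -> rat) : \sum_(x in X) G x = \sum_l \sum_(x in V l) G x.
Proof.
rewrite (partition_big cl xpredT) //=; apply: eq_bigr => l _.
by apply: eq_bigl => x; rewrite inE.
Qed.

Let sum_one (G : T -> rat) : (forall x, 0 <= G x) ->
  \sum_(x in X) (big (cl x))%:R * (\sum_(f | Fam f) G (f (cl x))) <= W * \sum_(x in X) G x.
Proof.
move=> G0; rewrite !sum_class mulr_sumr; apply: ler_sum => l _.
rewrite (eq_bigr (fun=> (big l)%:R * (\sum_(f | Fam f) G (f l)))); last first.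
  by move=> x; rewrite inE => /andP[_ /eqP ->].
rewrite sum_const; have := sum_one_representative F l G0; rewrite {1 4}/F.
case: (big l) => hl; first by rewrite mul1r mulrC.
by rewrite !mul0r mulr_ge0 ?ler0n ?sumr_ge0.
Qed.

Let sum_two (G : T -> T -> rat) : (forall x y, 0 <= G x y) ->
  \sum_(x in X) \sum_(y in X) ([&& big (cl x), big (cl y) & cl x != cl y])%:R *
    (\sum_(f | Fam f) G (f (cl y)) (f (cl x))) <= W * \sum_(x in X) \sum_(y in X) G y x.
Proof.
move=> G0; rewrite !sum_class mulr_sumr; apply: ler_sum => a _.
under eq_bigr do rewrite sum_class.
under [X in _ <= _ * X]eq_bigr do rewrite sum_class.
rewrite exchange_big [X in _ <= _ * X]exchange_big mulr_sumr; apply: ler_sum => b _ /=.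
rewrite (eq_bigr (fun=> (\sum_(y in V b) ([&& big a, big b & a != b])%:R * (\sum_(f | Fam f) G (f b) (f a))))); last first.
  move=> x; rewrite inE => /andP[_ /eqP ->]; apply: eq_bigr => y.
  by rewrite inE => /andP[_ /eqP ->].
rewrite !sum_const.
case: and3P => [[ba bb ab]|_]; last first.
  by rewrite !mul0r mulr_ge0 ?ler0n ?sumr_ge0 // => x _; rewrite sumr_ge0.
have := sum_two_representatives F ab (fun x y => G0 y x).
have -> : F a = V a by rewrite /F ba.
have -> : F b = V b by rewrite /F bb.
by rewrite mul1r -mulrA mulrC (mulrC (#|V b|%:R)).
Qed.

(** First moment method: for random [f] both the expected cost and the expected number of 4-cycles
    among representatives are small. *)
Lemma c4_free_approximation : 4 * err + 3 * h * n ^+ 2 < n ^+ 2 ->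
  exists e' : rel T, [/\ symmetric e', irreflexive e', (forall x y, e' x y -> x \in X),
    (forall a b c d, ~~ c4 e' a b c d) &
    \sum_(x in X) \sum_(y in X) (e x y != e' x y)%:R <= 4 * err + 3 * h * n ^+ 2].
Proof.
move=> small.
have [x0 _] : exists x : T, x \in T by apply/card_gt0P.
have n0 : 0 < n by rewrite ltr0n.
have n0W := ltW n0; have h0W := ltW h0.
have m1 : 1 <= m by rewrite ler1n; apply/card_gt0P; exists (cl x0).
have m0 : 0 < m by lra.
have tau0 : 0 < tau by rewrite /tau divr_gt0 ?mulr_gt0.
have tauF l : tau <= #|F l|%:R.
  rewrite /F; case: ifP => // _; rewrite cardsT -/n /tau ler_pdivrMr //.
  have : h * n <= 1 * n by rewrite ler_wpM2r.
  have : n * 1 <= n * m by rewrite ler_wpM2l.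
  lra.
have W0 : 0 < W.
  rewrite ltr0n; apply/card_gt0P.
  exists [ffun l => odflt x0 [pick x in F l]]; apply/familyP => l; rewrite ffunE.
  case: pickP => [//|F0]; have := tauF l; rewrite eq_card0 // => ?; lra.
have FamV f : Fam f -> forall l, big l -> f l \in V l.
  by move=> /familyP ff l bl; have := ff l; rewrite /F bl.
pose cost (f : {ffun L -> T}) : rat := \sum_(x in X) \sum_(y in X) (e x y != blowup big f x y)%:R.
pose bad (f : {ffun L -> T}) : rat := \sum_a \sum_b \sum_c \sum_d (c4 e (f a) (f b) (f c) (f d))%:R.
(* There are [m ^+ 4] quadruples of classes, each with probability at most [c4_count e / tau ^+ 4];
   [hc4] brings the total down to [h]. *)
have hbad : \sum_(f | Fam f) bad f <= W * h.
  have scL c : \sum_(a : L) c = c * m by rewrite sum_const_pred; congr (_ * _%:R); apply: eq_card.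
  have : tau ^+ 4 * \sum_(f | Fam f) bad f <= \sum_(a : L) \sum_(b : L) \sum_(c : L) \sum_(d : L) (W * c4_count e).
    rewrite /bad exchange_big mulr_sumr; apply: ler_sum => a _.
    rewrite exchange_big mulr_sumr; apply: ler_sum => b _.
    rewrite exchange_big mulr_sumr; apply: ler_sum => c _.
    rewrite exchange_big mulr_sumr; apply: ler_sum => d _.
    exact: sum_c4_representatives (ltW tau0) tauF.
  rewrite !scL => hS; set S := \sum_(f | Fam f) bad f in hS *.
  have hn0 : 0 < (h * n) ^+ 4 by rewrite exprn_gt0 // mulr_gt0.
  have m4 : 0 < m ^+ 4 by rewrite exprn_gt0.
  have tm : tau ^+ 4 * m ^+ 4 = (h * n) ^+ 4 by rewrite -exprMn /tau divfK // gt_eqF.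
  have H1 : tau ^+ 4 * S * m ^+ 4 <= W * c4_count e * m * m * m * m * m ^+ 4 by rewrite ler_pM2r.
  have H2 : W * (c4_count e * m ^+ 8) <= W * (h ^+ 5 * n ^+ 4) by rewrite ler_pM2l.
  have E1 : W * c4_count e * m * m * m * m * m ^+ 4 = W * (c4_count e * m ^+ 8) by ring.
  have E2 : W * (h ^+ 5 * n ^+ 4) = (h * n) ^+ 4 * (W * h) by ring.
  have E3 : tau ^+ 4 * S * m ^+ 4 = (h * n) ^+ 4 * S by rewrite -tm; ring.
  by rewrite -(ler_pM2l hn0) -E3 -E2; apply: le_trans H2; rewrite -E1.
have D0 u v : 0 <= D u v by rewrite ler0n.
have err0 : 0 <= err by apply: le_trans herr; apply: sumr_ge0 => x _; apply: sumr_ge0.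
(* Pairs meeting a small class account for [2 * h * n ^+ 2], and each of the four prediction terms
   for [err]. *)
have hcost : \sum_(f | Fam f) cost f <= W * (4 * err + 2 * h * n ^+ 2).
  have sF c : \sum_(f | Fam f) c = W * c by rewrite sum_const_pred mulrC.
  apply: (@le_trans _ _ (\sum_(x in X) \sum_(y in X)
     (W * (~~ big (cl x))%:R + W * (~~ big (cl y))%:R + W * D x y
      + (big (cl x))%:R * (\sum_(f | Fam f) (D (f (cl x)) y + D y (f (cl x))))
      + ([&& big (cl x), big (cl y) & cl x != cl y])%:R * (\sum_(f | Fam f) D (f (cl y)) (f (cl x)))))).
    rewrite /cost exchange_big; apply: ler_sum => x xX.
    rewrite exchange_big; apply: ler_sum => y yX.
    rewrite -!sF !mulr_sumr -!big_split; apply: ler_sum => f fF.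
    exact: blowup_cost (FamV f fF) xX yX.
  have small_sum : \sum_(x in X) (~~ big (cl x))%:R <= h * n.
    rewrite sum_class; apply: (@le_trans _ _ (\sum_(l : L) tau)).
      apply: ler_sum => l _; rewrite (eq_bigr (fun=> (~~ big l)%:R)); last first.
        by move=> x; rewrite inE => /andP[_ /eqP ->].
      rewrite sum_const; case: (boolP (big l)) => bl; first by rewrite mul0r ltW.
      by rewrite mul1r ltW // ltNge.
    rewrite sum_const_pred (_ : #|_|%:R = m); last by congr (_%:R); apply: eq_card.
    by rewrite /tau divfK // gt_eqF.
  have cX : #|X|%:R <= n by rewrite ler_nat max_card.
  have X0 : 0 <= #|X|%:R :> rat by rewrite ler0n.
  have hsX : (\sum_(x in X) (~~ big (cl x))%:R) * #|X|%:R <= h * n * n.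
    by apply: ler_pM => //; apply: sumr_ge0 => x _; rewrite ler0n.
  have t1 : \sum_(x in X) \sum_(y in X) W * (~~ big (cl x))%:R <= W * (h * n * n).
    under eq_bigr do rewrite sum_const -mulrA.
    by rewrite -mulr_sumr -mulr_suml ler_pM2l.
  have t2 : \sum_(x in X) \sum_(y in X) W * (~~ big (cl y))%:R <= W * (h * n * n).
    by rewrite sum_const -mulr_sumr -mulrA ler_pM2l.
  have t3 : \sum_(x in X) \sum_(y in X) W * D x y <= W * err.
    under eq_bigr do rewrite -mulr_sumr.
    by rewrite -mulr_sumr ler_pM2l.
  have t4 : \sum_(x in X) \sum_(y in X) (big (cl x))%:R * (\sum_(f | Fam f) (D (f (cl x)) y + D y (f (cl x)))) <= W * (2 * err).
    pose G x := \sum_(y in X) (D x y + D y x).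
    have G0 x : 0 <= G x by apply: sumr_ge0 => y _; rewrite addr_ge0.
    apply: le_trans (_ : W * \sum_(x in X) G x <= _).
      apply: le_trans (sum_one G0); apply: ler_sum => x _.
      by rewrite -mulr_sumr exchange_big.
    rewrite ler_pM2l // /G; under eq_bigr do rewrite big_split.
    rewrite big_split /= (_ : 2 * err = err + err); last by ring.
    by apply: lerD => //; rewrite exchange_big.
  have t5 : \sum_(x in X) \sum_(y in X) ([&& big (cl x), big (cl y) & cl x != cl y])%:R *
      (\sum_(f | Fam f) D (f (cl y)) (f (cl x))) <= W * err.
    apply: (le_trans (sum_two D0)); rewrite ler_pM2l // exchange_big; exact: herr.
  under eq_bigr do rewrite !big_split.
  rewrite !big_split /=.
  have -> : W * (4 * err + 2 * h * n ^+ 2) = W * (h * n * n) + W * (h * n * n) + W * err + W * (2 * err) + W * err by ring.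
  by rewrite !lerD.
(* With weight [n ^+ 2] a single 4-cycle would exceed the bound, so one average yields an [f] that
   is both cheap and free of 4-cycles. *)
have [f fF hf] : exists2 f, Fam f & cost f + n ^+ 2 * bad f <= 4 * err + 3 * h * n ^+ 2.
  have cF : #|Fam|%:R = W by [].
  have := @exists_le_average _ (fun f => cost f + n ^+ 2 * bad f) Fam; rewrite cF.
  case/(_ W0) => f fF; rewrite big_split -mulr_sumr /= => hf; exists f => //.
  rewrite -(ler_pM2l W0); apply: (le_trans hf).
  have : n ^+ 2 * (\sum_(f | Fam f) bad f) <= n ^+ 2 * (W * h) by rewrite ler_wpM2l ?exprn_ge0.
  lra.
have cost0 : 0 <= cost f by apply: sumr_ge0 => x _; apply: sumr_ge0 => y _; rewrite ler0n.
have fc4 a b c d : ~~ c4 e (f a) (f b) (f c) (f d).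
  apply/negP => H.
  have : 1 <= bad f.
    rewrite /bad (bigD1 a) //= (bigD1 b) //= (bigD1 c) //= (bigD1 d) //= H -!addrA lerDl.
    by rewrite !addr_ge0 ?sumr_ge0 // => *; rewrite ?sumr_ge0 // => *; rewrite ?sumr_ge0 // => *; rewrite ?sumr_ge0.
  have : n ^+ 2 * 1 <= n ^+ 2 * bad f -> False by move=> H2; lra.
  by move=> H2 H3; apply: H2; rewrite ler_wpM2l ?exprn_ge0.
exists (blowup big f); split.
- move=> x y; rewrite /blowup (eq_sym x) (eq_sym (cl x)) esym.
  by case: (x \in X); case: (y \in X); case: (y != x); case: (big (cl x)); case: (big (cl y)).
- by move=> x; rewrite /blowup eqxx /= !andbF.
- by move=> x y /andP[].
- exact: blowup_c4_free (FamV f fF) fc4.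
- have : 0 <= n ^+ 2 * bad f.
    by rewrite mulr_ge0 ?exprn_ge0 ?sumr_ge0 // => *; rewrite ?sumr_ge0 // => *; rewrite ?sumr_ge0 // => *; rewrite ?sumr_ge0.
  rewrite -/(cost f); lra.
Qed.
End Approximation.

(** * Attaching the sparse set to the approximation *)

(* The non-edges inside [S] form a graph without induced [2K2]: any non-edge
   [uv] meets the neighbourhood of every other one. *)
Lemma non_edge_cover (T : finType) (e : rel T) (S : {set T}) (D : rat) :
  symmetric e -> (forall a b c d, ~~ c4 e a b c d) -> 0 < D ->
  exists C : {set T}, [/\ C \subset S, #|C|%:R <= non_edges e S / D + 2 * D &
    forall x y, x \in S :\: C -> y \in S :\: C -> ~~ na e x y].
Proof.
move=> esym free D0.
pose N u := [set y in S | na e u y].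
pose Hi := [set x in S | D <= #|N x|%:R].
have NS u : N u \subset S by apply/subsetP => x; rewrite inE => /andP[].
have HiS : Hi \subset S by apply/subsetP => x; rewrite inE => /andP[].
have cHi : #|Hi|%:R <= non_edges e S / D.
  rewrite ler_pdivlMr // mulrC -sum_const.
  apply: (@le_trans _ _ (\sum_(x in Hi) #|N x|%:R)).
    by apply: ler_sum => x; rewrite inE => /andP[].
  apply: (@le_trans _ _ (\sum_(x in S) #|N x|%:R)).
    by apply: ler_sum_subset.
  apply: ler_sum => x _; rewrite card_indicator [leRHS]sum_in_indicator.
  by apply: ler_sum => y _; rewrite inE -natrM mulnb.
have lowN x : x \in S :\: Hi -> #|N x|%:R <= D.
  by rewrite !inE negb_and => /andP[/orP[/negPf ->//|]]; rewrite -ltNge => /ltW.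
have naC x y : na e x y = na e y x by rewrite /na esym eq_sym.
(* Either the vertices of high non-degree form a cover, or some non-edge [u v] avoids them; then the
   at most [2 * D] non-neighbours of [u] and [v] are added. *)
case: (boolP [exists u in S :\: Hi, exists v in S :\: Hi, na e u v]); last first.
  rewrite negb_exists_in => /forall_inP H; exists Hi; split => //.
    by rewrite (le_trans cHi) // lerDl mulr_ge0 // ltW.
  by move=> x y /H; rewrite negb_exists_in => /forall_inP; apply.
case/exists_inP => u uS /exists_inP[v vS uv].
exists (Hi :|: (N u :|: N v)); split.
- by rewrite !subUset HiS !NS.
- apply: (@le_trans _ _ (#|Hi|%:R + (#|N u|%:R + #|N v|%:R))).
    by rewrite -!natrD ler_nat (leq_trans (leq_card_setU _ _)) // leq_add2l leq_card_setU.
  have := lowN u uS; have := lowN v vS; lra.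
- have uS' : u \in S by move: uS; rewrite inE => /andP[].
  have vS' : v \in S by move: vS; rewrite inE => /andP[].
  have adj z : z \in S :\: (Hi :|: (N u :|: N v)) -> e u z && e v z.
    rewrite in_setD !in_setU !negb_or => /andP[/and3P[_ hu hv] zS].
    have {}hu : ~~ na e u z by apply: contra hu => h; rewrite /N in_set zS.
    have {}hv : ~~ na e v z by apply: contra hv => h; rewrite /N in_set zS.
    have zu : u != z by apply: contraTneq hv => <-; rewrite negbK naC.
    have zv : v != z by apply: contraTneq hu => <-; rewrite negbK.
    by move: hu hv; rewrite /na zu zv /= !negbK => -> ->.
  move=> x y /adj/andP[ux vx] /adj/andP[uy vy]; apply/negP => xy.
  move/negP: (free u x v y); apply.
  by rewrite /c4 ux (esym x) vx vy (esym y) uy uv xy.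
Qed.

Section Attach.
Variables (T : finType) (e e1 : rel T) (Y : {set T}) (C : T -> {set T}).
Hypotheses (esym : symmetric e) (e1sym : symmetric e1) (e1irr : irreflexive e1).
Hypothesis e1X : forall x y, e1 x y -> x \notin Y.
Hypothesis e1free : forall a b c d, ~~ c4 e1 a b c d.
Hypothesis CX : forall y, C y \subset ~: Y.
Hypothesis cover : forall y u v, y \in Y -> u \notin Y -> v \notin Y ->
  e y u -> e y v -> u \notin C y -> v \notin C y -> ~~ na e1 u v.

Let link y x := [&& y \in Y, x \notin Y, e y x & x \notin C y].

Definition attach : rel T := fun x y => [|| e1 x y, link x y | link y x].

Lemma attach_sym : symmetric attach.
Proof. by move=> x y; rewrite /attach e1sym; congr (_ || _); rewrite orbC. Qed.

Lemma attach_irr : irreflexive attach.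
Proof. by move=> x; rewrite /attach e1irr /link; case: (x \in Y). Qed.

Let attach_in y x : y \in Y -> attach y x -> link y x.
Proof.
move=> yY /or3P[/e1X|//|]; first by rewrite yY.
by case/and4P => _; rewrite yY.
Qed.

Let attach_out x y : x \notin Y -> y \notin Y -> attach x y = e1 x y.
Proof. by move=> /negPf xY /negPf yY; rewrite /attach /link xY yY /= !orbF. Qed.

(** [Y] is independent in [attach], so a 4-cycle through a vertex of [Y] has its two cycle
    neighbours outside [Y] and off the cover, where they cannot be non-adjacent. A 4-cycle avoiding
    [Y] lies in [e1]. *)
Lemma attach_c4_free a b c d : ~~ c4 attach a b c d.
Proof.
have main x y z v : x \in Y -> ~~ c4 attach x y z v.
  move=> xY; apply/negP => /and5P[xy _ _ vx /andP[_ yv]].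
  rewrite attach_sym in vx.
  case/and4P: (attach_in xY xy) => _ yY exy yC.
  case/and4P: (attach_in xY vx) => _ vY exv vC.
  move/negP: (cover xY yY vY exy exv yC vC); apply.
  by move: yv; rewrite /na attach_out.
have rot x y z v : c4 attach x y z v -> c4 attach y z v x.
  rewrite /c4 => /and5P[-> -> -> -> /andP[xz ->]] /=.
  by move: xz; rewrite /na eq_sym attach_sym.
apply/negP => H.
case: (boolP (a \in Y)) => aY; first by move/negP: (main a b c d aY); apply.
case: (boolP (b \in Y)) => bY; first by move/negP: (main b c d a bY); apply; apply/rot.
case: (boolP (c \in Y)) => cY; first by move/negP: (main c d a b cY); apply; do 2 apply/rot.
case: (boolP (d \in Y)) => dY; first by move/negP: (main d a b c dY); apply; do 3 apply/rot.
by move/negP: (e1free a b c d); apply; move: H; rewrite /c4 /na !attach_out.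
Qed.

(** Pairs are ordered: an edge deleted between [y] and its cover is met in both orders, whence the
    factor 2. *)
Lemma attach_cost :
  \sum_x \sum_y (e x y != attach x y)%:R <=
  \sum_(x in ~: Y) \sum_(y in ~: Y) (e x y != e1 x y)%:R + edge_count e Y
  + 2 * \sum_(y in Y) #|C y|%:R :> rat.
Proof.
have -> : \sum_(y in Y) #|C y|%:R = \sum_y \sum_x ((y \in Y) && (x \in C y))%:R :> rat.
  rewrite sum_in_indicator; apply: eq_bigr => y _; rewrite card_indicator mulr_sumr.
  by apply: eq_bigr => x _; rewrite -natrM mulnb.
rewrite (mulr_natl _ 2) mulr2n [X in _ + (X + _)]exchange_big /=.
rewrite /edge_count !sum2_in_indicator -!big_split; apply: ler_sum => x _.
rewrite -!big_split; apply: ler_sum => y _ /=.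
rewrite -!natrD ler_nat !inE.
have CY u v : u \in Y -> (u \in C v) = false.
  by move=> uY; apply/negP => /(subsetP (CX v)); rewrite inE uY.
have e1Y u v : u \in Y -> e1 u v = false.
  by move=> uY; apply/negP => /e1X; rewrite uY.
rewrite /attach /link.
case: (boolP (x \in Y)) => xY; case: (boolP (y \in Y)) => yY /=.
- by rewrite (e1Y _ _ xY); case: (e x y).
- by rewrite (e1Y _ _ xY) ?(CY _ _ xY) orbF; case: (e x y); case: (y \in C x).
- by rewrite e1sym (e1Y _ _ yY) ?(CY _ _ yY) (esym y); case: (e x y); case: (x \in C y).
- by case: (e x y); case: (e1 x y).
Qed.
End Attach.

(** * Choice of parameters and the final edited graph *)

(** With [delta = h ^+ 6] and [alpha = h ^+ 3], these are the bounds on the 4-cycle count that the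
    partition, the predictors, the blow-up and the sparse set require. The second dictates the
    constants: [54 = 6 + 12 * 4] and [256 = 4 ^ 4]. *)
Lemma c4_count_thresholds (R : realFieldType) (t h m n A : R) :
  h * t = 1 -> 0 < h <= 1 -> 1 <= m -> 0 < n -> 0 <= A ->
  A * (256 * t ^+ 54 * m ^+ 8) <= n ^+ 4 ->
  [/\ A < h ^+ 6 * (h ^+ 6 * (h ^+ 3) ^+ 2 / 2) ^+ 2 / 2 * n ^+ 4,
     A <= h ^+ 6 * (h ^+ 6 * (h ^+ 3) ^+ 2 / 4 * n) ^+ 4,
     A * m ^+ 8 <= h ^+ 5 * n ^+ 4 & A <= h ^+ 3 * n ^+ 4].
Proof.
move=> ht /andP[h0 h1] m1 n0 A0 hM.
have h0W := ltW h0.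
have n4 : 0 < n ^+ 4 by apply: exprn_gt0.
have Am : 256 * (A * m ^+ 8) <= h ^+ 54 * n ^+ 4.
  have : h ^+ 54 * (A * (256 * t ^+ 54 * m ^+ 8)) <= h ^+ 54 * n ^+ 4.
    by apply: ler_wpM2l hM; apply: exprn_ge0.
  have -> : h ^+ 54 * (A * (256 * t ^+ 54 * m ^+ 8)) = 256 * (A * m ^+ 8) * (h * t) ^+ 54.
    by rewrite exprMn; move: (t ^+ 54) (h ^+ 54) (m ^+ 8) => *; ring.
  by rewrite ht expr1n mulr1.
have AA : A <= A * m ^+ 8 by apply: ler_peMr => //; apply: exprn_ege1.
have AA0 : 0 <= A * m ^+ 8 by apply: le_trans AA.
have hn i : (i <= 54)%N -> h ^+ 54 * n ^+ 4 <= h ^+ i * n ^+ 4.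
  by move=> hi; apply: ler_wpM2r (ltW n4) _ _ (ler_wiXn2l h0W h1 hi).
have A54 : 0 < h ^+ 54 * n ^+ 4 by apply: mulr_gt0 n4; apply: exprn_gt0.
have A30 := hn 30 isT; have A5 := hn 5 isT; have A3 := hn 3 isT.
have E1 : h ^+ 6 * (h ^+ 6 * (h ^+ 3) ^+ 2 / 2) ^+ 2 / 2 * n ^+ 4 = (h ^+ 30 * n ^+ 4) / 8.
  have -> : h ^+ 30 = h ^+ 6 * (h ^+ 6 * h ^+ 6) ^+ 2 by rewrite -exprD -exprM -exprD.
  by rewrite -exprM; move: (h ^+ 6) (n ^+ 4) => *; field.
have E2 : h ^+ 6 * (h ^+ 6 * (h ^+ 3) ^+ 2 / 4 * n) ^+ 4 = h ^+ 54 * n ^+ 4 / 256.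
  have -> : h ^+ 54 = h ^+ 6 * (h ^+ 6 * h ^+ 6) ^+ 4 by rewrite -exprD -exprM -exprD.
  by rewrite -exprM; move: (h ^+ 6) => *; field.
rewrite E1 E2.
move: (h ^+ 54 * n ^+ 4) (h ^+ 30 * n ^+ 4) (h ^+ 5 * n ^+ 4) (h ^+ 3 * n ^+ 4) (A * m ^+ 8) Am AA AA0 A54 A30 A5 A3.
by clear => *; split; lra.
Qed.

(** With [h = 1 / t = g ^+ 2], the neighbourhoods of vertices of [Y] contain at most about
    [h * n ^+ 3] non-edges in total. The cover threshold [g * n] balances the two terms of
    [non_edge_cover], and the covers become the dominant cost, of order [g * n ^+ 2]. *)
Lemma near_c4_free_of_few_c4 (T : finType) (e : rel T) (t : nat) (g : rat) :
  symmetric e -> irreflexive e -> 0 < g -> g <= 1 / 100 -> t%:R * g ^+ 2 = 1 ->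
  t%:R ^+ 3 <= #|T|%:R :> rat ->
  let K := (4 * t ^ 12)%N in
  c4_count e * (256 * t%:R ^+ 54 * (K.+1 * t.+1 ^ K.+1)%:R ^+ 8) <= #|T|%:R ^+ 4 ->
  exists e' : rel T, [/\ symmetric e', irreflexive e', (forall a b c d, ~~ c4 e' a b c d) &
    \sum_x \sum_y (e x y != e' x y)%:R <= 76 * g * #|T|%:R ^+ 2].
Proof.
move=> esym eirr g0 g1 tg nt K hM; set n : rat := #|T|%:R in nt hM *.
have g0W := ltW g0.
have tp : 0 < t%:R :> rat by rewrite ltr0n lt0n; apply: contra_eqN tg => /eqP ->; rewrite mul0r eq_sym oner_eq0.
have tN0 : t%:R != 0 :> rat by rewrite gt_eqF.
set h : rat := t%:R^-1.
have hg : h = g ^+ 2 by apply: (mulfI tN0); rewrite mulfV // tg.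
have h0 : 0 < h by rewrite invr_gt0.
have h0W := ltW h0.
have hsmall : h <= g / 100 by rewrite hg expr2 ler_wpM2l //; lra.
have h1 : h <= 1 / 100 by lra.
have ht k : h ^+ k * t%:R ^+ k = 1 by rewrite -exprMn mulVf // expr1n.
have hexp i j : (i <= j)%N -> h ^+ j <= h ^+ i by move=> ij; apply: ler_wiXn2l => //; lra.
have t2 : (2 < t)%N.
  rewrite ltnNge; apply/negP => t2; have : t%:R <= 2 :> rat by rewrite ler_nat.
  have := ht 1%N; rewrite !expr1 => ht1 t2r.
  have : h * t%:R <= h * 2 by rewrite ler_wpM2l.
  lra.
have n0 : 0 < n by apply: lt_le_trans nt; rewrite exprn_gt0.
have n0W := ltW n0.
have T0 : (0 < #|T|)%N by rewrite -(ltr0n rat).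
have n4 : 0 < n ^+ 4 by rewrite exprn_gt0.
(* The lower bound on [n] absorbs the diagonal term of [sum_nbr_non_edges_le]. *)
have nn : n <= h ^+ 3 * n ^+ 2.
  have -> : h ^+ 3 * n ^+ 2 = h ^+ 3 * n * n by ring.
  rewrite ler_peMl //; have : h ^+ 3 * t%:R ^+ 3 <= h ^+ 3 * n by rewrite ler_wpM2l ?exprn_ge0.
  by rewrite ht.
have A0 := c4_count_ge0 e; set A := c4_count e in A0 hM.
set m : rat := (K.+1 * t.+1 ^ K.+1)%:R in hM.
have m1 : 1 <= m by rewrite ler1n muln_gt0 expn_gt0.
have unit i : 0 < h ^+ i.+1 <= 1 by rewrite exprn_gt0 // exprn_ile1 //; lra.
have ht1 : h * t%:R = 1 by rewrite mulVf.
have h01 : 0 < h <= 1 by rewrite h0; lra.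
have [cond1 cond3 cond4 A3] := c4_count_thresholds ht1 h01 m1 n0 A0 hM.
(* [K] is the reciprocal of the fraction [h ^+ 12 / 4] of vertices taken by each near-clique. *)
have cond2 : 1 <= h ^+ 6 * (h ^+ 3) ^+ 2 / 4 * K%:R.
  have -> : K%:R = 4 * t%:R ^+ 12 :> rat by rewrite natrM natrX.
  have -> : h ^+ 6 * (h ^+ 3) ^+ 2 / 4 * (4 * t%:R ^+ 12) = h ^+ 12 * t%:R ^+ 12 by field.
  by rewrite ht.
have [Y [col [hY nc]]] := near_clique_partition esym T0 (unit 2%N) (unit 5%N) cond1 cond2.
rewrite -/n in hY nc; set b := h ^+ 6 * _ / 4 * n in nc.
have b0 : 0 <= b by rewrite /b !mulr_ge0 ?exprn_ge0 ?invr_ge0.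
rewrite -/b in cond3; rewrite [in X in X * b ^+ 4]exprVn in cond3.
rewrite [h ^+ 6]exprVn in nc.
have [w [wcl hw]] := profile_predictor esym t2 b0 nc cond3.
rewrite -/n -/h in hw; set cl := degree_profile e Y col t in wcl hw.
have cardL : #|{: 'I_K.+1 * {ffun 'I_K.+1 -> 'I_t.+1}}|%:R = m :> rat.
  by rewrite card_prod card_ffun !card_ord.
rewrite -cardL in cond4.
have n2 : 0 < n ^+ 2 by rewrite exprn_gt0.
have hn2 : h * n ^+ 2 <= 1 / 100 * n ^+ 2 by rewrite ler_wpM2r // ltW.
have cond5 : 4 * (5 * h * n ^+ 2) + 3 * h * n ^+ 2 < n ^+ 2 by lra.
have h1' : h <= 1 by case/andP: h01.
have [e1 [s1 i1 X1 f1 cost1]] := c4_free_approximation esym eirr wcl T0 h0 h1' hw cond4 cond5.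
rewrite -/n in cost1; set E1 := \sum_(x in ~: Y) _ in cost1.
have {}cost1 : E1 <= 23 * h * n ^+ 2 by lra.
have gn0 : 0 < g * n by rewrite mulr_gt0.
pose S y := [set x in ~: Y | e y x].
have [C hC] := fin_all_exists (fun y => non_edge_cover (S y) s1 f1 gn0).
exists (attach e e1 Y C); split.
- exact: attach_sym.
- exact: attach_irr.
- apply: attach_c4_free => //.
    by move=> x y /X1; rewrite inE.
  move=> y u v yY uY vY eyu eyv uC vC; have [_ _] := hC y; apply.
    by rewrite !inE uC uY.
  by rewrite !inE vC vY.
have CX y : C y \subset ~: Y.
  have [CS _ _] := hC y; apply: subset_trans CS _.
  by apply/subsetP => x; rewrite inE => /andP[].
apply: (le_trans (attach_cost esym s1 _ CX)) => [x y /X1|]; first by rewrite inE.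
rewrite -/E1.
set F := \sum_(w in Y) non_edges e [set x in ~: Y | e w x].
(* The density [h ^+ 3] of [Y] leaves room for the square root: [F ^+ 2] is at most
   [3 * h ^+ 3 * n ^+ 6]. *)
have hF : F <= h * n ^+ 3.
  have F2 : F ^+ 2 <= n ^+ 2 * (A + n ^+ 2 * (edge_count e Y + n)) := sum_nbr_non_edges_le esym (~: Y) Y.
  have F0 : 0 <= F by apply: sumr_ge0 => y _; exact: non_edges_ge0.
  have hn3 : 0 <= h * n ^+ 3 by rewrite mulr_ge0 // exprn_ge0.
  rewrite -(@ler_pXn2r _ 2) ?nnegrE //; apply: (le_trans F2).
  have -> : (h * n ^+ 3) ^+ 2 = n ^+ 2 * (h ^+ 2 * n ^+ 4) by ring.
  rewrite ler_wpM2l ?exprn_ge0 //.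
  have : n ^+ 2 * (edge_count e Y + n) <= n ^+ 2 * (2 * (h ^+ 3 * n ^+ 2)).
    by rewrite ler_wpM2l ?exprn_ge0 //; lra.
  have -> : n ^+ 2 * (2 * (h ^+ 3 * n ^+ 2)) = 2 * h * (h ^+ 2 * n ^+ 4) by ring.
  have e3 : h ^+ 3 * n ^+ 4 = h * (h ^+ 2 * n ^+ 4) by ring.
  have : h * (h ^+ 2 * n ^+ 4) <= 1 / 100 * (h ^+ 2 * n ^+ 4) by apply: ler_wpM2r h1; apply: mulr_ge0; apply: exprn_ge0.
  have : 0 <= h ^+ 2 * n ^+ 4 by apply: mulr_ge0; apply: exprn_ge0.
  lra.
(* The covers concern non-edges of [e1], whereas [F] counts those of [e]. *)
have neS y : non_edges e1 (S y) <= non_edges e (S y) + E1.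
  have SX : S y \subset ~: Y by apply/subsetP => x; rewrite inE => /andP[].
  apply: (@le_trans _ _ (non_edges e (S y) + \sum_(u in S y) \sum_(v in S y) (e u v != e1 u v)%:R)).
    rewrite /non_edges -big_split; apply: ler_sum => u _; rewrite -big_split; apply: ler_sum => v _ /=.
    by rewrite -natrD ler_nat /na; case: (u == v); case: (e u v); case: (e1 u v).
  rewrite lerD2l /E1; apply: (@le_trans _ _ (\sum_(u in S y) \sum_(v in ~: Y) (e u v != e1 u v)%:R)).
    by apply: ler_sum => u _; apply: ler_sum_subset.
  by apply: ler_sum_subset => // u; apply: sumr_ge0.
have E10 : 0 <= E1 by apply: sumr_ge0 => x _; apply: sumr_ge0 => y _; rewrite ler0n.
have cY : #|Y|%:R <= n by rewrite ler_nat max_card.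
have hCs : \sum_(y in Y) #|C y|%:R <= 26 * g * n ^+ 2.
  apply: (@le_trans _ _ (\sum_(y in Y) ((non_edges e (S y) + E1) / (g * n) + 2 * (g * n)))).
    apply: ler_sum => y _; have [_ cC _] := hC y; apply: (le_trans cC).
    by rewrite lerD2r ler_wpM2r ?invr_ge0 ?(ltW gn0).
  rewrite big_split sum_const -mulr_suml big_split sum_const /= -/F.
  have c1 : 2 * (g * n) * #|Y|%:R <= 2 * (g * n) * n by rewrite ler_wpM2l // mulr_ge0 // ltW.
  have c2 : E1 * #|Y|%:R <= 23 * h * n ^+ 2 * n by apply: ler_pM => //; rewrite ler0n.
  have c3 : (F + E1 * #|Y|%:R) / (g * n) <= 24 * g * n ^+ 2.
    rewrite (ler_pdivrMr _ _ gn0).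
    have -> : 24 * g * n ^+ 2 * (g * n) = 24 * h * n ^+ 3 by rewrite hg; ring.
    have : 23 * h * n ^+ 2 * n = 23 * h * n ^+ 3 by ring.
    lra.
  have : 2 * (g * n) * n = 2 * g * n ^+ 2 by ring.
  lra.
have : h ^+ 3 * n ^+ 2 <= h * n ^+ 2 by rewrite ler_wpM2r ?exprn_ge0 // -[leRHS]expr1 hexp.
have : h * n ^+ 2 <= g / 100 * n ^+ 2 by rewrite ler_wpM2r ?exprn_ge0.
have : 0 <= g * n ^+ 2 by rewrite mulr_ge0 ?exprn_ge0.
lra.
Qed.

(** * Labelled quadruples versus induced copies *)

Lemma c4_induces (n : nat) (e : rel 'I_n) a b c d :
  irreflexive e -> c4 e a b c d -> induces_C4 e [set a; b; c; d].
Proof.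
move=> eirr /and5P[ab bc cd da /andP[/andP[nac eac] /andP[nbd ebd]]].
have neq x y : e x y -> x != y by apply: contraTneq => ->; rewrite eirr.
apply/existsP; exists a; apply/existsP; exists b; apply/existsP; exists c; apply/existsP; exists d.
rewrite eqxx ab bc cd da eac ebd !andbT /= -!setUA !cardsU1 cards1 !inE.
by rewrite !negb_or !(neq _ _ ab, neq _ _ bc, neq _ _ cd, nac, nbd) (eq_sym a d) (neq _ _ da).
Qed.

(** [c4] asks opposite vertices to differ, which [induces_C4] ensures through the size of the
    set. *)
Lemma induced_C4_free_of_c4_free (n : nat) (e : rel 'I_n) :
  (forall a b c d, ~~ c4 e a b c d) -> induced_C4_free e.
Proof.
move=> free S; apply/negP => /existsP[a /existsP[b /existsP[c /existsP[d]]]].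
case/and5P => /eqP -> card4 ab bc /and3P[cd da /andP[ac bd]].
have card_le3 (x y z : 'I_n) : (#|[set x; y; z]| <= 3)%N.
  by rewrite -setUA !cardsU1 cards1; do 2 case: (_ \notin _).
have not4 (x y z : 'I_n) : [set a; b; c; d] \subset [set x; y; z] -> False.
  by move=> /subset_leq_card; rewrite (eqP card4) => /leq_trans /(_ (card_le3 x y z)).
move/negP: (free a b c d); apply; rewrite /c4 /na ab bc cd da ac bd !andbT /=.
apply/andP; split; apply/eqP => E.
  apply: (not4 c b d); apply/subsetP => x; rewrite !inE E.
  by case: (x == c); case: (x == b); case: (x == d).
apply: (not4 a d c); apply/subsetP => x; rewrite !inE E.
by case: (x == a); case: (x == d); case: (x == c).
Qed.

(** A labelled 4-cycle is one of the [4 ^ 4] quadruples from its vertex set, a crude substitute for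
    the exact count 8. *)
Lemma c4_count_le_num (n : nat) (e : rel 'I_n) :
  irreflexive e -> c4_count e <= 256 * (num_induced_C4 e)%:R.
Proof.
move=> eirr; pose P S := induces_C4 e S.
apply: (@le_trans _ _ (\sum_(S | P S) \sum_a \sum_b \sum_c \sum_d
    ([&& a \in S, b \in S, c \in S & d \in S])%:R)).
  rewrite /c4_count [leRHS]exchange_big; apply: ler_sum => a _.
  rewrite [leRHS]exchange_big; apply: ler_sum => b _.
  rewrite [leRHS]exchange_big; apply: ler_sum => c _.
  rewrite [leRHS]exchange_big; apply: ler_sum => d _ /=.
  case hc: (c4 e a b c d); last by apply: sumr_ge0 => S _; rewrite ler0n.
  rewrite (bigD1 [set a; b; c; d]) /=; last exact: c4_induces.
  by rewrite !inE !eqxx ?orbT /= lerDl; apply: sumr_ge0 => S _; rewrite ler0n.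
rewrite /num_induced_C4 cardsE -sum_const_pred; apply: ler_sum => S PS.
have cS : #|S| = 4%N.
  by case/existsP: PS => a /existsP[b /existsP[c /existsP[d /and3P[_ /eqP -> _]]]].
apply: (@le_trans _ _ (\sum_(a in S) \sum_(b in S) \sum_(c in S) \sum_(d in S) 1)).
  rewrite [leRHS]sum_in_indicator; apply: ler_sum => a _.
  rewrite [X in _ <= _ * X]sum_in_indicator mulr_sumr; apply: ler_sum => b _.
  rewrite [X in _ <= _ * (_ * X)]sum_in_indicator !mulr_sumr; apply: ler_sum => c _.
  rewrite [X in _ <= _ * (_ * (_ * X))]sum_in_indicator !mulr_sumr; apply: ler_sum => d _.
  by rewrite mulr1 -!natrM !mulnb.
rewrite !sum_const cS; lra.
Qed.

(** * The exponent and the counting bound over the integers *)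

(** For [u = t ^ 12] the right side is [t ^ 15], and the left side collects the binary exponents in
    [exponent_bound]. *)
Lemma exponent_arith (t u : nat) : (100 <= t)%N -> (1 <= u)%N ->
  (8 + (8 + t * 54 + (4 * u + t * (4 * u).+1) * 8) <= t * t * (t * u))%N.
Proof.
move=> t100 u1.
have b1 : (100 * u <= t * u)%N by rewrite leq_mul2r t100 orbT.
have b2 : (100 * (t * u) <= t * (t * u))%N by rewrite leq_mul2r t100 orbT.
have b3 : (t <= t * u)%N by rewrite leq_pmulr.
have b4 : (100 * (t * (t * u)) <= t * (t * (t * u)))%N by rewrite leq_mul2r t100 orbT.
have -> : (t * (4 * u).+1 = t + 4 * (t * u))%N by rewrite mulnS mulnCA.
rewrite -[leqRHS]mulnA.
move: (t * (t * (t * u)))%N (t * (t * u))%N (t * u)%N b1 b2 b3 b4 => x y z b1 b2 b3 b4.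
lia.
Qed.

(** Origin of 240: [t <= q ^ 16], the binary logarithm of the left side is at most [t ^ 15], and
    [16 * 15 = 240]. One factor 256 comes from [c4_count_le_num], the other from
    [c4_count_thresholds]. *)
Lemma exponent_bound (q t K : nat) :
  (2 <= q)%N -> t = ((100 * q) ^ 2)%N -> K = (4 * t ^ 12)%N ->
  (256 * (256 * t ^ 54 * (K.+1 * t.+1 ^ K.+1) ^ 8) <= 2 ^ (q ^ 240))%N.
Proof.
move=> q2 tE KE.
have tq : (t <= q ^ 16)%N.
  have : (100 ^ 2 <= q ^ 14)%N.
    by apply: (@leq_trans (2 ^ 14)); rewrite // leq_exp2r.
  move=> h; rewrite tE expnMn; apply: (@leq_trans (q ^ 14 * q ^ 2)); first by rewrite leq_mul2r h orbT.
  by rewrite -expnD.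
have t100 : (100 <= t)%N.
  rewrite tE expnMn; apply: (@leq_trans (100 ^ 2 * 1)) => //.
  by rewrite leq_mul2l expn_gt0 (leq_trans _ q2).
clear tE.
have p2 k : (k < 2 ^ k)%N by apply: ltn_expl.
have hm : (K.+1 * t.+1 ^ K.+1 <= 2 ^ (K + t * K.+1))%N.
  by rewrite expnD leq_mul // expnM leq_exp2r.
have h8 : ((K.+1 * t.+1 ^ K.+1) ^ 8 <= 2 ^ ((K + t * K.+1) * 8))%N by rewrite expnM leq_exp2r.
have h54 : (t ^ 54 <= 2 ^ (t * 54))%N by rewrite expnM leq_exp2r // ltnW.
apply: (@leq_trans (2 ^ 8 * (2 ^ 8 * 2 ^ (t * 54) * 2 ^ ((K + t * K.+1) * 8)))).
  by rewrite leq_mul // leq_mul // leq_mul.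
rewrite -!expnD leq_exp2l //.
apply: (@leq_trans (t ^ 15)); last by rewrite (expnM q 16 15) leq_exp2r.
rewrite KE.
have e15 : (t ^ 15 = t * t * (t * t ^ 12))%N by rewrite !expnS !mulnA.
have t12 : (1 <= t ^ 12)%N by rewrite expn_gt0 (leq_trans _ t100).
rewrite e15; exact: exponent_arith.
Qed.

(** The factor 100 exceeds the 76 of [near_c4_free_of_few_c4], so [76 * g] stays below [1 / q]. *)
Lemma scale_properties (q t : nat) (g : rat) :
  (0 < q)%N -> t = ((100 * q) ^ 2)%N -> g = (100 * q%:R)^-1 ->
  [/\ 0 < g, g <= 1 / 100, q%:R * g = 1 / 100 & t%:R * g ^+ 2 = 1].
Proof.
move=> q0 tE gE.
have qr : 0 < q%:R :> rat by rewrite ltr0n.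
have c0 : 0 < 100 * q%:R :> rat by apply: mulr_gt0.
have c1 : 100 * q%:R * g = 1 by rewrite gE (mulfV (lt0r_neq0 c0)).
have g0 : 0 < g by rewrite gE invr_gt0.
have qg : q%:R * g = 1 / 100 by move: c1; rewrite -mulrA; lra.
split; [exact: g0 | | exact: qg |].
  rewrite -qg; apply: ler_peMl; first exact: ltW.
  by rewrite ler1n.
have -> : t%:R = (100 * q%:R) ^+ 2 :> rat by rewrite tE natrX natrM.
by rewrite -exprMn c1 expr1n.
Qed.

(** Here [q] stands for the reciprocal of [eps]. With fewer copies, [near_c4_free_of_few_c4] would
    give an induced-C4-free graph too close to [e]. *)
Lemma num_induced_C4_ge (n q : nat) (e : rel 'I_n) :
  simple_graph e -> (2 <= q)%N ->
  (forall e' : rel 'I_n, simple_graph e' -> induced_C4_free e' -> n ^ 2 <= q * edit_dist e e')%N ->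
  (n ^ 4 <= 2 ^ (q ^ 240) * num_induced_C4 e)%N.
Proof.
move=> [esym eirr] q2 far; have [n0|n0] := posnP n.
  by have -> : (n ^ 4 = 0)%N by rewrite n0.
have [t tE] : {t | t = ((100 * q) ^ 2)%N} by exists ((100 * q) ^ 2)%N.
have [K KE] : {K | K = (4 * t ^ 12)%N} by exists (4 * t ^ 12)%N.
have hM := exponent_bound q2 tE KE.
apply: leq_trans (leq_mul hM (leqnn _)).
have q0 : (0 < q)%N by apply: leq_trans q2.
have t0 : (0 < t)%N by rewrite tE expn_gt0 muln_gt0 q0.
set m := ((K.+1 * t.+1 ^ K.+1) ^ 8)%N.
have m0 : (0 < m)%N by rewrite expn_gt0 muln_gt0 expn_gt0.
(* For [n < t ^ 3] a single copy suffices, and [far] supplies it because [e] is at distance 0 from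
   itself. *)
case: (leqP (t ^ 3) n) => nt; last first.
  have N0 : (0 < num_induced_C4 e)%N.
    rewrite lt0n; apply/negP => /eqP N0.
    have free : induced_C4_free e.
      move=> S; apply/negP => HS; have := card0_eq N0 S; rewrite inE HS //.
    have := far e (conj esym eirr) free.
    rewrite /edit_dist (_ : [set p | _] = set0); last by apply/setP => p; rewrite !inE eqxx andbF.
    by rewrite cards0 muln0 leqn0 expn_eq0 eqn0Ngt n0.
  apply: (@leq_trans ((t ^ 3) ^ 4)); first by rewrite leq_exp2r // ltnW.
  rewrite -expnM; apply: (@leq_trans (t ^ 54)); first by rewrite leq_pexp2l.
  apply: (leq_trans _ (leq_pmulr _ N0)); apply: (leq_trans _ (leq_pmull _ _)) => //.
  by apply: (leq_trans _ (leq_pmulr _ m0)); apply: leq_pmull.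
rewrite leqNgt; apply/negP => small.
have n0r : 0 < n%:R :> rat by rewrite ltr0n.
have qr : 0 < q%:R :> rat by rewrite ltr0n.
have [g gE] : {g : rat | g = (100 * q%:R)^-1} by exists (100 * q%:R)^-1.
have [g0 g1 qg tg] := scale_properties q0 tE gE.
have nt' : t%:R ^+ 3 <= #|'I_n|%:R :> rat by rewrite card_ord -natrX ler_nat.
have hcount : c4_count e * (256 * t%:R ^+ 54 * (K.+1 * t.+1 ^ K.+1)%:R ^+ 8) <= #|'I_n|%:R ^+ 4.
  rewrite card_ord -!natrX -!natrM -/m.
  apply: (@le_trans _ _ (256 * (num_induced_C4 e)%:R * (256 * t ^ 54 * m)%:R)).
    by apply: ler_wpM2r; [exact: ler0n | exact: c4_count_le_num].
  rewrite -!natrM ler_nat; apply: ltnW; apply: leq_ltn_trans small.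
  by rewrite mulnAC; exact: leqnn.
rewrite KE in hcount.
have [e' [s1 i1 f1 cost]] := near_c4_free_of_few_c4 esym eirr g0 g1 tg nt' hcount.
have := far e' (conj s1 i1) (induced_C4_free_of_c4_free f1).
apply/negP; rewrite -ltnNge -(ltr_nat rat) natrM.
have ed : (edit_dist e e')%:R <= 76 * g * n%:R ^+ 2.
  rewrite card_ord in cost; apply: le_trans cost.
  rewrite pair_bigA /edit_dist card_indicator; apply: ler_sum => p _.
  by rewrite inE ler_nat; case: (p.1 < p.2)%N => //=; case: (e _ _ != _).
have : q%:R * (edit_dist e e')%:R <= q%:R * (76 * g * n%:R ^+ 2) by rewrite ler_pM2l.
have -> : q%:R * (76 * g * n%:R ^+ 2) = 76 * (q%:R * g) * n%:R ^+ 2 by ring.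
rewrite qg natrX; have : 0 < n%:R ^+ 2 :> rat by rewrite exprn_gt0.
lra.
Qed.

End InducedC4.

(** * Passage to real exponents *)

Import Lra.

Lemma INR_muln (a b : nat) : INR (a * b)%N = (INR a * INR b)%R.
Proof. by rewrite -mult_INR. Qed.

Lemma INR_expn (a b : nat) : INR (expn a b) = (INR a ^ b)%R.
Proof. by elim: b => [|b IH] //; rewrite expnS INR_muln IH. Qed.

Lemma INR_leq (a b : nat) : (a <= b)%N -> (INR a <= INR b)%R.
Proof. by move/leP/le_INR. Qed.

Lemma leq_INR (a b : nat) : (INR a <= INR b)%R -> (a <= b)%N.
Proof. by move/INR_le/leP. Qed.

(** Reversal maps the increasing pairs injectively to pairs that are not increasing. Comparison with
    the empty graph will give [eps <= 1 / 2]. *)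
Lemma edit_dist_empty_le (n : nat) (e : rel 'I_n) :
  (2 * edit_dist e (fun _ _ => false) <= expn n 2)%N.
Proof.
set A := [set p : 'I_n * 'I_n | (p.1 < p.2)%N].
have hA : (edit_dist e (fun _ _ => false) <= #|A|)%N.
  by apply/subset_leq_card/subsetP => p; rewrite !inE => /andP[].
pose sw (p : 'I_n * 'I_n) := (p.2, p.1).
have swI : injective sw by move=> [a b] [c d] [-> ->].
apply: (@leq_trans (2 * #|A|)); first by rewrite leq_mul2l.
have -> : expn n 2 = #|{: 'I_n * 'I_n}| by rewrite card_prod card_ord mulnn.
rewrite mul2n -addnn -{2}(card_imset A swI).
have -> : (#|A| + #|sw @: A| = #|A :|: sw @: A|)%N.
  rewrite cardsU [A :&: _](_ : _ = set0) ?cards0 ?subn0 //.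
  apply/setP => -[a b]; rewrite !inE /=; apply/negP => /andP[ab /imsetP[[c d]]].
  rewrite inE /= => cd [E1 E2]; move: ab; rewrite E1 E2 => dc.
  by move: (ltn_trans cd dc); rewrite ltnn.
exact: max_card.
Qed.

Theorem theorem1p1 :
  exists c : R, (0 < c)%R /\
    forall (eps : R) (n : nat) (e : rel 'I_n),
      (0 < eps < 1)%R ->
      simple_graph e ->
      eps_far_C4free e eps ->
      (INR n ^ 4 / Rpower 2 (Rpower (/ eps) c) <= INR (num_induced_C4 e))%R.
Proof.
(* Bounding [q] by the square of [/ eps] doubles the exponent 240. *)
exists (INR (2 * 240)); split; first by apply: lt_0_INR; apply/ltP.
move=> eps n e [eps0 eps1] he far.
have pow0 x : (0 < Rpower 2 x)%R by apply: exp_pos.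
have [n0|npos] := posnP n.
  have -> : INR n = 0%R by rewrite n0.
  rewrite /Rdiv /= !Rmult_0_l; exact: pos_INR.
have INRn : (0 < INR n)%R by apply/lt_0_INR/ltP.
have n2 : (0 < INR n ^ 2)%R by apply: pow_lt.
(* Deleting all edges is an admissible edit. The resulting bound is needed for [q <= (/ eps) ^ 2],
   which fails for [eps] near 1. *)
have eps2 : (eps <= 1 / 2)%R.
  have sE : simple_graph (fun _ _ : 'I_n => false) by [].
  have fE : induced_C4_free (fun _ _ : 'I_n => false).
    move=> S; apply/negP => /existsP[a /existsP[b /existsP[c /existsP[d]]]].
    by case/and3P.
  have := far _ sE fE; have := INR_leq (edit_dist_empty_le e).
  rewrite INR_muln INR_expn /= => h1 h2; nra.
have inv2 : (2 <= / eps)%R.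
  have -> : 2%R = (/ (1 / 2))%R by field.
  by apply: Rinv_le_contravar.
(* The least integer above [/ eps]. *)
set q := Z.to_nat (up (/ eps)).
have [up1 up2] := archimed (/ eps).
have upz : (0 <= up (/ eps))%Z by apply: le_IZR; lra.
have INRq : INR q = IZR (up (/ eps)) by rewrite INR_IZR_INZ /q Znat.Z2Nat.id.
have q2 : (2 <= q)%N by apply: leq_INR; rewrite INRq /=; lra.
have qle : (INR q <= (/ eps) ^ 2)%R by rewrite INRq /=; nra.
have key : (expn n 4 <= expn 2 (expn q 240) * num_induced_C4 e)%N.
  apply: InducedC4.num_induced_C4_ge => // e' se' fe'.
  have h := far e' se' fe'; apply: leq_INR; rewrite INR_expn INR_muln.
  have ed0 := pos_INR (edit_dist e e').
  have : (/ eps * (eps * INR n ^ 2) <= / eps * INR (edit_dist e e'))%R.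
    by apply: Rmult_le_compat_l => //; lra.
  have -> : (/ eps * (eps * INR n ^ 2) = INR n ^ 2)%R by field; lra.
  have : (/ eps * INR (edit_dist e e') <= INR q * INR (edit_dist e e'))%R.
    by apply: Rmult_le_compat_r => //; rewrite INRq; lra.
  lra.
have := INR_leq key; rewrite INR_muln !INR_expn => {}key.
apply: (Rmult_le_reg_r (Rpower 2 (Rpower (/ eps) (INR (2 * 240))))) => //.
rewrite /Rdiv Rmult_assoc Rinv_l ?Rmult_1_r; last by apply: Rgt_not_eq.
apply: (Rle_trans _ _ _ key); rewrite Rmult_comm.
apply: Rmult_le_compat_l; first exact: pos_INR.
have -> : INR 2 = 2%R by [].
rewrite -Rpower_pow; last lra.
apply: Rle_Rpower; first lra.
rewrite INR_expn Rpower_pow; last by apply: Rinv_0_lt_compat.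
rewrite pow_mult; apply: pow_incr; split => //; exact: pos_INR.
Qed.
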